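(* There exist absolute constants $c, C > 0$ such that the following holds. Let $k$ be a positive integer, let $F \subsetneq H$ be graphs on the same set of $k$ vertices (i.e. $F$ is a proper subgraph of $H$ with $V(F)=V(H)$), and let $0<\epsilon<1$. Then there is a finite ($k$-partite) graph $G$ such that every $\epsilon$-$(H,F)$-regular partition of $G$ has order (number of parts) at least $$\operatorname{twr}\Big(\frac{1}{\epsilon^{c}\, k^{Ck}}\Big).$$
   Context: All graphs are finite and simple. A $k$-partite graph comes with $k$ specified vertex classes, with all edges between distinct classes. The tower function is defined by $\operatorname{twr}(0)=1$ and $\operatorname{twr}(n)=2^{\operatorname{twr}(n-1)}$ for integers $n\ge 1$; for a non-integer real $x\ge 0$, $\operatorname{twr}(x)$ means $\operatorname{twr}(\lfloor x\rfloor)$ (floor signs are omitted). For a $k$-vertex graph $H$ and a $k$-partite graph $G$, $n_H(G)$ is the number of unlabeled copies of $H$ in $G$ (subgraphs of $G$, not necessarily induced, isomorphic to $H$) in which distinct vertices lie in distinct vertex classes of $G$. For a subgraph $F\subseteq H$, also on $k$ vertices, the $(H,F)$-coefficient of $G$ is $c_{H,F}(G)=n_H(G)/n_F(G)$. The notation $x\pm\epsilon$ denotes a number in the interval $[x-\epsilon,x+\epsilon]$. A $k$-partite graph $G$ is $\epsilon$-$(H,F)$-regular if for every induced $k$-partite subgraph $G'$ of $G$ (obtained by taking a subset of each vertex class) with $n_F(G')\ge \epsilon\, n_F(G)$ we have $c_{H,F}(G')=c_{H,F}(G)\pm\epsilon$. A partition $\mathcal P$ of the vertex set of $G$ is $\epsilon$-$(H,F)$-regular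 if all but at most $\epsilon\, n_H(G)$ of the copies of $H$ in $G$ (those counted by $n_H(G)$) lie in induced $k$-partite subgraphs $G[X_1,\dots,X_k]$, with $X_1,\dots,X_k\in\mathcal P$, that are $\epsilon$-$(H,F)$-regular. Here $G[X_1,\dots,X_k]$ is the $k$-partite graph with classes $X_1,\dots,X_k$ whose edges are the edges of $G$ between $X_i$ and $X_j$, $i\ne j$ (if some of the $X_i$ coincide, they are treated as disjoint copies), and a copy of $H$ lies in it if its vertices can be ordered $v_1,\dots,v_k$ with $v_i\in X_i$ for all $i$. *)

(* Defs.v *)
From HB Require Import structures.
From mathcomp Require Import all_boot all_order all_algebra.
From mathcomp Require Import reals exp.

Set Implicit Arguments.
Unset Strict Implicit.
Unset Printing Implicit Defensive.

Import Order.TTheory GRing.Theory Num.Theory.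

Local Open Scope ring_scope.

Fixpoint twr (n : nat) : nat := if n is m.+1 then (2 ^ twr m)%N else 1%N.

(* For 0 <= x, [Num.truncn x] is the integer part of x. *)
Definition rtwr (R : realType) (x : R) : nat := twr (Num.truncn x).

Record sgraph (V : finType) := SGraph {
  adj :> rel V;
  adj_sym : symmetric adj;
  adj_irr : irreflexive adj
}.

Definition edges (V : finType) (G : sgraph V) : {set {set V}} :=
  [set [set p.1; p.2] | p in [set p : V * V | G p.1 p.2]].

Record kpartite (k : nat) (V : finType) := KPartite {
  kgraph :> sgraph V;
  vclass : V -> 'I_k;
  vclassP : forall u v, kgraph u v -> vclass u != vclass v
}.

Section Copies.
Variables (k : nat) (T V : finType).

(* A subgraph is a pair (vertex set, edge set); isolated vertices matter, so
   the vertex set is part of the data. *)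
Definition iso_subgraph (H : sgraph T) (S : {set V} * {set {set V}}) : bool :=
  [exists f : {ffun T -> V},
    [&& injectiveb f, S.1 == [set f x | x : T]
      & S.2 == [set f @: (e : {set T}) | e in edges H]]].

Definition copies (H : sgraph T) (G : kpartite k V) :
    {set {set V} * {set {set V}}} :=
  [set S : {set V} * {set {set V}} |
    [&& S.2 \subset edges G, iso_subgraph H S
      & [forall u in S.1, forall v in S.1,
           (u != v) ==> (vclass G u != vclass G v)]]].

Definition ncopies (H : sgraph T) (G : kpartite k V) : nat := #|copies H G|.

(* Only meaningful when [ncopies F G] is nonzero. For F a spanning subgraph of
   H, [ncopies F G = 0] forces [ncopies H G = 0], and the value here is 0. *)
Definition coeff (R : realType) (H F : sgraph T) (G : kpartite k V) : R :=
  (ncopies H G)%:R / (ncopies F G)%:R.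

End Copies.

Section Induced.
Variables (k : nat) (V : finType) (G : kpartite k V).

Section SubClasses.
Variable U : {set V}.

Definition induced_adj : rel {x : V | x \in U} :=
  fun x y => G (val x) (val y).

Lemma induced_adj_sym : symmetric induced_adj.
Proof. by move=> x y; rewrite /induced_adj adj_sym. Qed.

Lemma induced_adj_irr : irreflexive induced_adj.
Proof. by move=> x; rewrite /induced_adj adj_irr. Qed.

Lemma induced_classP (x y : {x : V | x \in U}) :
  SGraph induced_adj_sym induced_adj_irr x y ->
  vclass G (val x) != vclass G (val y).
Proof. exact: vclassP. Qed.

(* Choosing a subset of each vertex class amounts to choosing a subset U of V. *)
Definition induced : kpartite k {x : V | x \in U} :=
  @KPartite k _ (SGraph induced_adj_sym induced_adj_irr)
    (fun x => vclass G (val x)) induced_classP.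

End SubClasses.

Section Parts.
Variable X : {ffun 'I_k -> {set V}}.

(* The vertex (i, v) is the copy of v in the class X i; the sets X i may
   coincide and need not lie inside the vertex classes of G. *)
Definition parts_vertex : finType := {p : 'I_k * V | p.2 \in X p.1}.

Definition parts_adj : rel parts_vertex :=
  fun p q => ((val p).1 != (val q).1) && G (val p).2 (val q).2.

Lemma parts_adj_sym : symmetric parts_adj.
Proof. by move=> p q; rewrite /parts_adj eq_sym adj_sym. Qed.

Lemma parts_adj_irr : irreflexive parts_adj.
Proof. by move=> p; rewrite /parts_adj eqxx. Qed.

Lemma parts_classP (p q : parts_vertex) :
  SGraph parts_adj_sym parts_adj_irr p q -> (val p).1 != (val q).1.
Proof. by case/andP. Qed.

Definition parts_graph : kpartite k parts_vertex :=
  @KPartite k _ (SGraph parts_adj_sym parts_adj_irr)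
    (fun p => (val p).1) parts_classP.

Definition lies_in_parts (S : {set V} * {set {set V}}) : bool :=
  [exists v : {ffun 'I_k -> V},
    [&& injectiveb v, S.1 == [set v i | i : 'I_k]
      & [forall i, v i \in X i]]].

End Parts.
End Induced.

Definition regular_graph (R : realType) (k : nat) (T V : finType) (eps : R)
    (H F : sgraph T) (G : kpartite k V) : bool :=
  [forall U : {set V},
    (eps * (ncopies F G)%:R <= (ncopies F (induced G U))%:R) ==>
    (`|coeff R H F (induced G U) - coeff R H F G| <= eps)].

Definition in_regular_parts (R : realType) (k : nat) (T V : finType) (eps : R)
    (H F : sgraph T) (G : kpartite k V) (P : {set {set V}})
    (S : {set V} * {set {set V}}) : bool :=
  [exists X : {ffun 'I_k -> {set V}},
    [&& [forall i, X i \in P], regular_graph eps H F (parts_graph G X)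
      & lies_in_parts X S]].

Definition regular_partition (R : realType) (k : nat) (T V : finType) (eps : R)
    (H F : sgraph T) (G : kpartite k V) (P : {set {set V}}) : Prop :=
  partition P [set: V] /\
  #|[set S in copies H G | ~~ in_regular_parts eps H F G P S]|%:R
    <= eps * (ncopies H G)%:R.

(* Main.v *)
Require Import Defs.
From mathcomp Require Import all_boot all_order all_algebra.
From mathcomp Require Import reals exp.
From mathcomp Require Import boolp zify lra.

Import Order.TTheory GRing.Theory Num.Theory.

Set Implicit Arguments.
Unset Strict Implicit.
Unset Printing Implicit Defensive.

(** Why the theorem is true.

    All pairs of vertex classes of the graph are complete, except one pair
    [i0], [i1] which carries a chain of [L + 1] blocks of equal size, lying
    alternately in the two classes. Block [r] is cut into [msize r] clusters of
    equal size. Every cluster of block [r + 1] has a codeword of length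
    [msize r], whose bits tell to which clusters of block [r] it is completely
    joined; to the other ones it is not joined at all. Codes of relative
    distance 1/64 can have exponentially many words ([gilbert_varshamov]), so
    [msize] grows like a tower ([msize_growth]).

    A regular partition is forced to follow the clusters, block after block.
    Call a vertex good if its part has a noticeable piece in its block and if
    most of that piece is in its own cluster. In block 0, which is one cluster,
    most vertices are good. If most vertices of block [r] are good, let [Y] be
    a part with a noticeable piece in block [r + 1]. When the codewords of the
    vertices of that piece are balanced at a coordinate [i], the densities
    between cluster [i] and two large pieces of [Y] are 0 and 1, so [Y] is
    irregular with the parts of the good vertices of cluster [i]. As there are
    few irregular copies, for most parts [Y] almost all coordinates are unbalanced, and then
    most vertices of the piece have the same codeword ([refine_step]).

    The height of the tower is polynomial in 1/epsilon because no constant is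
    lost from one block to the next. A few coordinates [i] stay uncontrolled,
    namely those of the clusters of block [r] with many bad vertices. But two
    different codewords disagree on so many coordinates that the uncontrolled
    ones account for at most half of the disagreements; the other half is on
    unbalanced coordinates, where disagreements are rare ([concentration]).
    Hence the proportion of bad vertices in block [r + 1] depends only on the
    number of irregular copies, not on the proportion in block [r], and one
    bound, 1/512, holds for all blocks. In the last block different clusters
    with good vertices give different parts ([parts_ge]).

    General graphs [F] and [H] come in through the two values of the
    coefficient: when the density between [i0] and [i1] is 1 or 0 in a
    subgraph, the numbers of copies are the number of transversals times a
    number of placements in the complete graph, with or without one edge. The
    two coefficients differ since [H] has more edges than [F]
    ([separating_pair], [irregular_tuple]), and irregular pairs of vertices
    extend to a proportion of at least [2^-k] of the transversals, each of
    which carries an irregular copy of [H] ([few_irr_pairs]). *)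

(** * Placements of a graph on the vertex classes *)

Lemma mem_edges (V : finType) (G : sgraph V) (u v : V) :
  ([set u; v] \in edges G) = G u v.
Proof.
apply/imsetP/idP => [[[a b]]|Guv]; last by exists (u, v); rewrite ?inE.
rewrite inE /= => Gab eqE.
have ab : a != b by apply: contraTneq Gab => ->; rewrite adj_irr.
have: (a \in [set u; v]) && (b \in [set u; v]) by rewrite eqE !inE !eqxx orbT.
rewrite !inE; case/andP=> /orP[]/eqP ea /orP[]/eqP eb; subst => //;
  by rewrite ?eqxx // in ab; rewrite adj_sym.
Qed.

Lemma edgesP (V : finType) (G : sgraph V) (e : {set V}) :
  reflect (exists u v, G u v /\ e = [set u; v]) (e \in edges G).
Proof.
apply: (iffP imsetP) => [[[a b]]|[u [v [Guv ->]]]].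
  by rewrite inE => Gab ->; exists a, b.
by exists (u, v); rewrite ?inE.
Qed.

Lemma imset_pair (A B : finType) (f : A -> B) (u v : A) :
  f @: [set u; v] = [set f u; f v].
Proof. by rewrite imsetU1 imset_set1. Qed.

Section Placements.
Variables T I : finType.

(** The copies of [F] in the complete graph on [I], given by their edge sets:
    isolated vertices carry no information, as all copies are spanning. *)
Definition placements (F : sgraph T) : {set {set {set I}}} :=
  [set [set f @: (e : {set T}) | e in edges F] |
     f : {ffun T -> I} & injectiveb f].

Lemma placementsP (F : sgraph T) (E : {set {set I}}) :
  reflect (exists2 f : {ffun T -> I}, injective f &
             E = [set f @: (e : {set T}) | e in edges F])
          (E \in placements F).
Proof.
apply: (iffP imsetP) => [[f]|[f fI ->]].
  by rewrite !inE => /injectiveP fI ->; exists f.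
by exists f; rewrite // !inE; apply/injectiveP.
Qed.

Lemma placement_edge (F : sgraph T) E e : E \in placements F -> e \in E ->
  exists i j, i != j /\ e = [set i; j].
Proof.
case/placementsP=> f fI -> /imsetP[_ /edgesP[u [v [Fuv ->]]] ->].
exists (f u), (f v); rewrite imset_pair; split=> //.
by rewrite inj_eq //; apply: contraTneq Fuv => ->; rewrite adj_irr.
Qed.

Lemma card_placement (F : sgraph T) E :
  E \in placements F -> #|E| = #|edges F|.
Proof.
by case/placementsP=> f fI ->; rewrite card_imset //; apply: imset_inj.
Qed.

Lemma placements_gt0 (F : sgraph T) : #|T| = #|I| -> (0 < #|placements F|)%N.
Proof.
move=> TI; apply/card_gt0P.
pose f := [ffun x : T => enum_val (cast_ord TI (enum_rank x))].
exists [set f @: (e : {set T}) | e in edges F]; apply/placementsP.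
exists f => // x y; rewrite !ffunE.
by move/enum_val_inj/cast_ord_inj/enum_rank_inj.
Qed.

Lemma placements_le (F : sgraph T) : #|T| = #|I| ->
  (#|placements F| <= #|I| ^ #|I|)%N.
Proof.
move=> TI; apply: leq_trans (leq_imset_card _ _) _.
by rewrite (leq_trans (max_card _)) // card_ffun TI.
Qed.

Definition avoiding (F : sgraph T) (e : {set I}) : {set {set {set I}}} :=
  [set E in placements F | e \notin E].

(** Double counting of the pairs formed by a placement and one of its edges. *)
Lemma sum_containing (F : sgraph T) :
  (\sum_(e : {set I}) #|[set E in placements F | e \in E]|
     = #|placements F| * #|edges F|)%N.
Proof.
under eq_bigr => e _ do rewrite -sum1dep_card.
rewrite (exchange_big_dep (mem (placements F))) /=; last by move=> ? ? _ /andP[].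
rewrite -sum_nat_const; apply: eq_bigr => E EF.
by rewrite sum1dep_card -(card_placement EF); apply: eq_card => e; rewrite !inE EF.
Qed.

(** Deleting a suitable edge [e] of the complete graph destroys a larger
    proportion of the copies of [H] than of the copies of [F]: summed over all
    [e], the destroyed proportions give the numbers of edges of [H] and [F]. *)
Lemma separating_pair (F H : sgraph T) : #|T| = #|I| ->
  (#|edges F| < #|edges H|)%N ->
  exists i j : I, i != j /\
    (#|avoiding H [set i; j]| * #|placements F|
       < #|placements H| * #|avoiding F [set i; j]|)%N.
Proof.
move=> TI ltFH.
pose B (G : sgraph T) (e : {set I}) := #|[set E in placements G | e \in E]|.
have [e lte|noe] := pickP (fun e => (B F e * #|placements H| < B H e * #|placements F|)%N).
  have [E0 HE0 eE0] : exists2 E0, E0 \in placements H & e \in E0.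
    have /card_gt0P[E0] : (0 < B H e)%N.
      by rewrite lt0n; apply: contraTneq lte => ->; rewrite ltn0.
    by rewrite inE => /andP[? ?]; exists E0.
  have [i [j [ij def_e]]] := placement_edge HE0 eE0.
  exists i, j; split=> //; rewrite -def_e.
  have split_ G : (#|placements G| = B G e + #|avoiding G e|)%N.
    rewrite -(cardsID [set E : {set {set I}} | e \in E]) /B /avoiding.
    by congr (_ + _)%N; apply: eq_card => E; rewrite !inE // andbC.
  move: lte; rewrite (split_ F) (split_ H).
  move: (B F e) (B H e) #|avoiding F e| #|avoiding H e| => bF bH aF aH.
  rewrite !(mulnDl, mulnDr); lia.
have: (\sum_(e : {set I}) B H e * #|placements F| <= \sum_(e : {set I}) B F e * #|placements H|)%N.
  by apply: leq_sum => e _; rewrite leqNgt noe.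
rewrite -!big_distrl /= !sum_containing.
have := placements_gt0 H TI; have := placements_gt0 F TI.
move: #|placements H| #|placements F| => nH nF nF0 nH0.
by rewrite mulnAC [X in (_ <= X)%N]mulnAC (mulnC nF) leq_pmul2l ?muln_gt0 ?nH0 // leqNgt ltFH.
Qed.

End Placements.

(** * Counting copies by transversals *)

(** The classes are counted through a map [cl] with the same fibers as
    [vclass], so that the counts also apply when the classes of a subgraph are
    a permutation of the classes of the ambient graph. *)
Section CountCopies.
Variables (k : nat) (T W I : finType) (G : kpartite k W) (cl : W -> I).
Hypothesis cl_class : forall u v, (cl u == cl v) = (vclass G u == vclass G v).
Hypothesis card_T : #|T| = #|I|.

Definition transversals : {set {ffun I -> W}} :=
  [set t : {ffun I -> W} | [forall i, cl (t i) == i]].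

Lemma transversalsP (t : {ffun I -> W}) :
  reflect (forall i, cl (t i) = i) (t \in transversals).
Proof. by rewrite inE; apply: (iffP forallP) => h i; apply/eqP; rewrite h. Qed.

Lemma card_transversals :
  #|transversals| = (\prod_i #|[set u | cl u == i]|)%N.
Proof.
transitivity #|family (fun i => mem [set u | cl u == i])|.
  apply: eq_card => t; rewrite inE; apply: eq_forallb => i.
  by rewrite /= inE.
by rewrite card_family foldrE big_map big_enum.
Qed.

Definition placed_copy (p : {ffun I -> W} * {set {set I}}) :
    {set W} * {set {set W}} :=
  ([set p.1 i | i : I], [set p.1 @: (e : {set I}) | e in p.2]).

Lemma placed_copy_inj :
  {in [pred p | p.1 \in transversals] &, injective placed_copy}.
Proof.
move=> [t E] [t' E'] /transversalsP /= tP /transversalsP /= t'P [eqV eqE].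
have tt' : t = t'.
  apply/ffunP => i; have : t i \in [set t' j | j : I] by rewrite -eqV imset_f.
  by case/imsetP => j _ e; rewrite e; congr (t' _); rewrite -[LHS]t'P -e tP.
congr (_, _) => //; rewrite -{}tt' in eqE.
apply: (imset_inj (f := fun e : {set I} => t @: e)) eqE.
by apply: imset_inj; apply: can_inj tP.
Qed.

(** A copy with one vertex in each class is a transversal together with a
    placement on the set of classes; together with [placed_copy_inj] this
    reduces the counting of copies to pairs. *)
Lemma copies_placed (F : sgraph T) :
  copies F G = placed_copy @: [set p | [&& p.1 \in transversals,
    p.2 \in placements I F & [set p.1 @: (e : {set I}) | e in p.2] \subset edges G]].
Proof.
apply/setP => -[S E]; apply/idP/imsetP; last first.
  case=> [[t E0]]; rewrite inE /= => /and3P[/transversalsP tP E0F sub] [-> ->].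
  rewrite inE /= sub /=; apply/andP; split; last first.
    apply/forall_inP => _ /imsetP[i _ ->]; apply/forall_inP => _ /imsetP[j _ ->].
    by apply/implyP => tij; rewrite -cl_class !tP; apply: contraNneq tij => ->.
  have [f fI defE0] := placementsP _ _ E0F.
  apply/existsP; exists [ffun x => t (f x)].
  apply/and3P; split.
  - by apply/injectiveP => x y; rewrite !ffunE => /(can_inj tP)/fI.
  - apply/eqP/setP => w; apply/imsetP/imsetP => [[i _ ->]|[x _ ->]] /=.
      have [g fg gf] : bijective f by apply: inj_card_bij; rewrite // card_T.
      by exists (g i); rewrite // ffunE gf.
    by exists (f x); rewrite // ffunE.
  rewrite defE0 -imset_comp; apply/eqP/eq_imset => e /=.
  by rewrite -imset_comp; apply: eq_imset => x; rewrite ffunE.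
rewrite inE /= => /and3P[sub /existsP[f /and3P[/injectiveP fI /eqP /= defS /eqP /= defE]]].
move/forall_inP => clS.
pose g := [ffun x => cl (f x)].
have gI : injective g.
  move=> x y; rewrite !ffunE => /eqP; rewrite cl_class => exy.
  have fS z : f z \in S by rewrite defS imset_f.
  have /forall_inP/(_ _ (fS y)) := clS _ (fS x).
  by rewrite exy implybF negbK => /eqP/fI.
have [h gh hg] : bijective g by apply: inj_card_bij; rewrite // card_T.
pose t := [ffun i => f (h i)].
have tg x : t (g x) = f x by rewrite ffunE gh.
have tE : [set t @: (e : {set I}) | e in [set g @: (e : {set T}) | e in edges F]]
        = [set f @: (e : {set T}) | e in edges F].
  rewrite -imset_comp; apply: eq_imset => e /=.
  by rewrite -imset_comp; apply: eq_imset => x; rewrite /= tg.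
exists (t, [set g @: (e : {set T}) | e in edges F]); rewrite ?inE /=.
  apply/and3P; split.
  - by apply/forallP => i; rewrite -{2}[i]hg !ffunE.
  - by apply/placementsP; exists g.
  by rewrite tE -defE.
congr (_, _) => /=.
  rewrite defS; apply/setP => w; apply/imsetP/imsetP => [[x _ ->]|[i _ ->]].
    by exists (g x); rewrite // tg.
  by exists (h i); rewrite // ffunE.
by rewrite tE.
Qed.

Lemma ncopies_le (F : sgraph T) :
  (ncopies F G <= (\prod_i #|[set u | cl u == i]|) * #|placements I F|)%N.
Proof.
rewrite /ncopies copies_placed -card_transversals -cardsX.
apply: leq_trans (leq_imset_card _ _) _; apply: subset_leq_card.
by apply/subsetP => -[t E]; rewrite !inE /= => /and3P[-> ->].
Qed.

(** The two extreme cases, where the pair of classes [e] has density 1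
    ([b = true]) or 0: whether a placement gives a copy does not depend on the
    transversal. *)
Lemma ncopies_blowup (F : sgraph T) (b : bool) (e : {set I}) :
    (forall u v, G u v = (cl u != cl v) && (b || ([set cl u; cl v] != e))) ->
  ncopies F G = ((\prod_i #|[set u | cl u == i]|) *
     #|[set E in placements I F | b || (e \notin E)]|)%N.
Proof.
move=> defG; rewrite /ncopies copies_placed -card_transversals -cardsX.
rewrite card_in_imset; last first.
  move=> p q; rewrite inE => /and3P[p1 _ _]; rewrite inE => /and3P[q1 _ _].
  exact: placed_copy_inj.
apply: eq_card => -[t E]; rewrite [RHS]inE !inE /=.
case: forallP => //= tP; case EF: (E \in _) => //=.
have {}tP i : cl (t i) = i by apply/eqP.
apply/subsetP/idP => [sub|].
  case: b defG => //= defG; apply/negP => eE.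
  have [i [j [ij def_e]]] := placement_edge EF eE.
  have := sub (t @: e); rewrite imset_f // def_e imset_pair mem_edges defG !tP.
  by rewrite -def_e eqxx andbF => /(_ isT).
move=> be _ /imsetP[e0 e0E ->].
have [i [j [ij def_e]]] := placement_edge EF e0E.
rewrite def_e imset_pair mem_edges defG !tP ij /= -def_e.
by case: b be {defG} => //=; apply: contraNneq => <-.
Qed.

End CountCopies.

(** * Tuples of parts that are not regular *)

Section IrregularTuple.
Local Open Scope ring_scope.

Variables (R : realType) (k : nat) (T V : finType) (eps : R) (H F : sgraph T).
Variables (G : kpartite k V) (X : {ffun 'I_k -> {set V}}).
Hypothesis card_T : #|T| = k.

Lemma card_parts_class (i : 'I_k) :
  #|[set p : parts_vertex X | (val p).1 == i]| = #|X i|.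
Proof.
pose h (p : parts_vertex X) := (val p).2.
rewrite -(card_in_imset (f := h)) => [|p q]; last first.
  rewrite !inE => /eqP p1 /eqP q1 pq; apply: val_inj.
  by rewrite [val p]surjective_pairing [val q]surjective_pairing p1 q1 -/(h p) pq.
apply: eq_card => v; apply/imsetP/idP => [[p]|vX].
  by rewrite inE => /eqP <- ->; apply: (valP p).
by exists (exist _ (i, v) vX); rewrite ?inE.
Qed.

(** The map [s] tells which class of [G] is wanted inside the part [X i]: the
    parts need not respect the classes, and a copy may visit these in any
    order. *)
Definition subparts (s : 'I_k -> 'I_k) (D : {set V}) : {set parts_vertex X} :=
  [set p | (vclass G (val p).2 == s (val p).1) && ((val p).2 \in D)].

Lemma card_subparts_class (s : 'I_k -> 'I_k) (D : {set V}) (i : 'I_k) :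
    injective s ->
  #|[set p : {x | x \in subparts s D} | vclass G (val (val p)).2 == s i]|
    = #|[set v in X i :&: D | vclass G v == s i]|.
Proof.
move=> sI.
pose h (p : {x | x \in subparts s D}) := (val (val p)).2.
have part_of p : vclass G (h p) == s i -> (val (val p)).1 = i.
  move=> hp; have := valP p; rewrite inE -/(h p) (eqP hp) => /andP[/eqP/sI-> _].
  by [].
rewrite -(card_in_imset (f := h)) => [|p q]; last first.
  rewrite !inE => /part_of p1 /part_of q1 pq; apply/val_inj/val_inj.
  rewrite [LHS]surjective_pairing [RHS]surjective_pairing p1 q1.
  by rewrite -/(h p) pq.
apply: eq_card => v; apply/imsetP/idP => [[p]|].
  rewrite inE => hp ->; rewrite !inE -(part_of p hp) (valP (val p)) /=.
  by have := valP p; rewrite inE andbC.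
rewrite !inE => /andP[/andP[vX vD] vs].
have pU : (exist _ (i, v) vX : parts_vertex X) \in subparts s D by rewrite inE vD vs.
by exists (exist (fun x => x \in subparts s D) _ pU); rewrite ?inE.
Qed.

(** The test sets [D true] and [D false] give subgraphs with the coefficients
    [N H / N F] and [a H / a F], with [a] counting the placements that avoid
    [e]. Their difference is a positive rational number with denominator at
    most [(k ^ k) ^ 2], so they cannot both be within [eps] of the coefficient
    of the whole tuple. *)
Lemma irregular_tuple (e : {set 'I_k}) (s : 'I_k -> 'I_k) (D : bool -> {set V}) :
    injective s ->
    (#|avoiding H e| * #|placements 'I_k F|
       < #|placements 'I_k H| * #|avoiding F e|)%N ->
    (forall b, {in D b &, forall u v, G u v = (vclass G u != vclass G v)
        && (b || ([set vclass G u; vclass G v] != e))}) ->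
    eps * (2 * (k ^ k) ^ 2)%:R < 1 -> 0 <= eps ->
    (forall b, eps * (k ^ k * \prod_i #|X i|)%:R
       <= (\prod_i #|[set v in X i :&: D b | vclass G v == s i]|)%:R) ->
    (forall b, 0 < \prod_i #|[set v in X i :&: D b | vclass G v == s i]|)%N ->
  ~~ regular_graph eps H F (parts_graph G X).
Proof.
move=> sI sep blowD small eps0 big pos; apply/negP => /forallP reg.
have card_TI : #|T| = #|'I_k| by rewrite card_ord.
pose N (F' : sgraph T) := #|placements 'I_k F'|.
pose n b := (\prod_i #|[set v in X i :&: D b | vclass G v == s i]|)%N.
pose a (F' : sgraph T) b := #|[set E in placements 'I_k F' | b || (e \notin E)]|.
have a1 F' : a F' true = N F' by apply: eq_card => E; rewrite inE andbT.
have a0 F' : a F' false = #|avoiding F' e| by [].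
have NkF : (N F <= k ^ k)%N.
  by have := placements_le F card_TI; rewrite card_ord.
have aN : (a F false <= N F)%N.
  by apply: subset_leq_card; apply/subsetP => E; rewrite inE => /andP[].
have aF0 b : (0 < a F b)%N.
  case: b; first by rewrite a1 placements_gt0.
  by rewrite a0 lt0n; apply: contraTneq sep => ->; rewrite muln0.
have ncE F' b : ncopies F' (induced (parts_graph G X) (subparts s (D b))) = (n b * a F' b)%N.
  pose cl (p : {x | x \in subparts s (D b)}) := vclass G (val (val p)).2.
  have clE p : cl p = s (val (val p)).1.
    by apply/eqP; have := valP p; rewrite inE => /andP[].
  rewrite (@ncopies_blowup k T _ _ _ cl _ card_TI _ b e); last first.
    move=> p q /=; rewrite /induced_adj /= /parts_adj.
    have Dp (p' : {x | x \in subparts s (D b)}) : (val (val p')).2 \in D b.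
      by have := valP p'; rewrite inE => /andP[].
    have -> : ((val (val p)).1 != (val (val q)).1) = (cl p != cl q).
      by rewrite !clE (inj_eq sI).
    by rewrite (blowD b _ _ (Dp p) (Dp q)) andbA andbb.
  - by move=> p q; rewrite !clE (inj_eq sI).
  - congr (_ * _)%N; rewrite /n (reindex_inj sI); apply: eq_bigr => i _.
    exact: card_subparts_class.
have ncF_le : (ncopies F (parts_graph G X) <= k ^ k * \prod_i #|X i|)%N.
  have := @ncopies_le k T _ _ (parts_graph G X) (fun p => (val p).1) _ card_TI F.
  move=> /(_ (fun u v => erefl)) /leq_trans; apply.
  rewrite mulnC leq_mul //; apply: eq_leq; apply: eq_bigr => i _.
  exact: card_parts_class.
have coef b : `|(a H b)%:R / (a F b)%:R - coeff R H F (parts_graph G X)| <= eps.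
  have := implyP (reg (subparts s (D b))).
  have n0 : (n b)%:R != 0 :> R by rewrite pnatr_eq0 -lt0n pos.
  rewrite /coeff !ncE !natrM -mulf_div divff // mul1r; apply.
  apply: (@le_trans _ _ (eps * (k ^ k * \prod_i #|X i|)%:R)).
    by rewrite ler_wpM2l // ler_nat.
  by apply: le_trans (big b) _; rewrite -natrM ler_nat leq_pmulr.
have := coef true; have := coef false; rewrite !a1 !ler_norml.
set c := coeff _ _ _ _ => /andP[c0 _] /andP[_ c1].
have gap : (N H)%:R / (N F)%:R - (a H false)%:R / (a F false)%:R <= 2 * eps.
  lra.
have NF0 : (0 < N F)%N by rewrite -a1.
have : 1 <= (N H * a F false)%:R - (a H false * N F)%:R :> R.
  by rewrite -natrB ?ler1n ?subn_gt0 // ltnW.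
have prod_le : (N F * a F false <= (k ^ k) ^ 2)%N.
  by rewrite leq_mul // (leq_trans aN).
move=> num; move: gap.
have aF0R : (a F false)%:R != 0 :> R by rewrite pnatr_eq0 -lt0n.
have NF0R : (N F)%:R != 0 :> R by rewrite pnatr_eq0 -lt0n.
rewrite -mulNr addf_div // ler_pdivrMr -?natrM ?ltr0n ?muln_gt0 ?NF0 ?aF0 //.
rewrite mulNr -natrM => gap.
have : 1 <= eps * (2 * (k ^ k) ^ 2)%:R.
  rewrite (le_trans num) //; apply: le_trans gap _.
  rewrite [eps * _]mulrC (natrM _ 2) [leRHS]mulrAC.
  by apply: ler_wpM2l; rewrite ?mulr_ge0 // ler_nat.
lra.
Qed.

End IrregularTuple.

(** * Refinement passes from one block to the next *)

Lemma card_pairs (A B : finType) (r : A -> B -> bool) :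
  #|[set p : A * B | r p.1 p.2]| = (\sum_a #|[set b | r a b]|)%N.
Proof.
rewrite -sum1dep_card -(pair_big_dep predT r (fun _ _ => 1%N)) /=.
by apply: eq_bigr => a _; rewrite sum1dep_card.
Qed.

Lemma card_fibers (A B : finType) (f : A -> B) (S : {set A}) :
  #|S| = (\sum_b #|[set a in S | f a == b]|)%N.
Proof.
rewrite -sum1_card (partition_big f predT) //=.
by apply: eq_bigr => b _; rewrite sum1dep_card.
Qed.

Lemma card_uniform (V : finType) (m s : nat) (A : {set V}) (q : V -> 'I_m) :
  (forall i, #|[set x in A | q x == i]| = s) -> #|A| = (m * s)%N.
Proof.
move=> fiber; rewrite (card_fibers q) (eq_bigr (fun=> s)) => [|i _]; last exact: fiber.
by rewrite sum_nat_const card_ord.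
Qed.
(** [S] is the piece of one part in a block, [w] gives the codewords and [cl]
    the clusters. *)
Section Concentration.
Variables (V C : finType) (m g : nat) (S : {set V}).
Variables (cl : V -> C) (w : V -> 'I_m -> bool).

Definition balanced (i : 'I_m) :=
  [forall b, #|S| <= g * #|[set y in S | w y i == b]|]%N.

Definition minority : {set V} :=
  [set y in S | 2 * #|[set y' in S | cl y' == cl y]| <= #|S|]%N.

(** Let [D] be the number of pairs in [S] from different clusters. They
    disagree on [D * m / 64] coordinates in total, at least. A balanced
    coordinate accounts for at most [D] disagreements, so all balanced
    coordinates together for at most half of the total. An unbalanced one
    accounts for at most [2 * #|S| ^ 2 / g], since one of its two bits is
    rare. Hence [D] is at most [256 * #|S| ^ 2 / g], and every vertex of
    [minority] is in at least [#|S| / 2] of the pairs. *)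
Lemma concentration : (0 < m)%N ->
    {in S &, forall y y', cl y != cl y' ->
       (m <= 64 * #|[set i | w y i != w y' i]|)%N} ->
    (128 * #|[set i | balanced i]| <= m)%N ->
  (g * #|minority| <= 512 * #|S|)%N.
Proof.
move=> m_gt0 far few.
pose Dif (p : V * V) := [&& p.1 \in S, p.2 \in S & cl p.1 != cl p.2].
pose D := #|[set p | Dif p]|; pose n := #|S|.
(* all disagreements of the pairs counted by [D] *)
have Dle : (D * m <= 64 * \sum_i #|[set p | Dif p & w p.1 i != w p.2 i]|)%N.
  have -> : (\sum_i #|[set p | Dif p & w p.1 i != w p.2 i]|
    = \sum_(p | Dif p) #|[set i | w p.1 i != w p.2 i]|)%N.
    rewrite -(card_pairs (fun i p => Dif p && (w p.1 i != w p.2 i))).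
    rewrite -sum1dep_card.
    rewrite -(pair_big_dep predT (fun i p => Dif p && (w p.1 i != w p.2 i)) (fun _ _ => 1%N)).
    rewrite (exchange_big_dep Dif) /=; last by move=> i p _ /andP[].
    by apply: eq_bigr => p pD; rewrite sum1dep_card; apply: eq_card => i; rewrite !inE pD.
  rewrite /D -sum1dep_card big_distrl big_distrr /=; apply: leq_sum => p /and3P[p1 p2 p12].
  by rewrite mul1n far.
have sum_le : (g * \sum_i #|[set p | Dif p & w p.1 i != w p.2 i]|
    <= g * D * #|[set i | balanced i]| + 2 * n ^ 2 * m)%N.
  rewrite big_distrr /= (bigID balanced) /= leq_add //.
    rewrite -sum1dep_card big_distrr /=; apply: leq_sum => i _; rewrite muln1 leq_mul2l.
    by rewrite subset_leq_card ?orbT //; apply/subsetP => p; rewrite !inE => /andP[].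
  rewrite -[X in (_ <= _ * X)%N]card_ord -sum1_card big_distrr /=.
  rewrite [X in (_ <= X)%N](bigID balanced) /=.
  apply: leq_trans (leq_addl _ _); apply: leq_sum => i /forallPn[b].
  rewrite -ltnNge -/n muln1 => rare.
  pose a b := #|[set y in S | w y i == b]|.
  (* a disagreement at [i] pairs the rare bit with the frequent one *)
  have aD : (a b + a (~~ b) = n)%N.
    rewrite /n -(cardsID [set y | w y i == b] S) /a; congr (_ + _)%N.
      by apply: eq_card => y; rewrite !inE.
    by apply: eq_card => y; rewrite !inE; case: (w y i) b {rare} => -[]; rewrite ?andbT ?andbF.
  apply: (@leq_trans (g * (2 * (a b * a (~~ b))))).
    rewrite leq_mul2l; apply/orP; right.
    rewrite mul2n -addnn {1}mulnC -!cardsX.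
    apply: leq_trans (leq_card_setU _ _); apply: subset_leq_card.
    apply/subsetP => -[y y']; rewrite !inE /= => /andP[/and3P[/= -> -> _]] /=.
    by case: (w y i) (w y' i) b {rare aD} => -[] [].
  rewrite -/(a b) in rare; rewrite !expnS expn0 muln1.
  have : (a (~~ b) <= n)%N by rewrite -aD leq_addl.
  move: (a b) (a (~~ b)) rare => x y; clear; nia.
have mino : (#|minority| * n <= 2 * D)%N.
  have -> : D = (\sum_y #|[set y' | Dif (y, y')]|)%N.
    by rewrite -(card_pairs (fun y y' => Dif (y, y'))); apply: eq_card => -[].
  rewrite -sum1_card big_distrl big_distrr /= big_mkcond /=; apply: leq_sum => y _.
  case: ifP => //; rewrite inE => /andP[yS]; rewrite mul1n -/n.
  have -> : n = (#|[set y' in S | cl y' == cl y]| + #|[set y' | Dif (y, y')]|)%N.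
    rewrite /n -(cardsID [set y' | cl y' == cl y] S); congr (_ + _)%N.
      by apply: eq_card => y'; rewrite !inE.
    by apply: eq_card => y'; rewrite !inE /Dif /= yS andbC eq_sym.
  lia.
have [n0|n_gt0] := posnP n.
  by rewrite (_ : #|minority| = 0)%N ?muln0 //; apply/eqP; rewrite -leqn0 -n0
     subset_leq_card //; apply/subsetP => y; rewrite inE => /andP[].
rewrite -/n -(leq_pmul2r n_gt0) -(leq_pmul2r m_gt0).
move: mino sum_le Dle few; clear n_gt0.
move: #|minority| #|[set i | balanced i]| (\sum_i _)%N D n => M sp Sg D0 n0.
clear; rewrite expnS expn1 => h1 h2 h3 h4.
have h5 : (g * D0 * m <= 256 * (n0 * n0) * m)%N.
  have e1 : (g * (D0 * m) <= g * (64 * Sg))%N by rewrite leq_mul2l h3 orbT.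
  have e2 : (g * D0 * (128 * sp) <= g * D0 * m)%N by rewrite leq_mul2l h4 orbT.
  have e3 : (g * (64 * Sg) = 64 * (g * Sg))%N by rewrite mulnCA.
  have e4 : (g * D0 * (128 * sp) = 128 * (g * D0 * sp))%N by rewrite mulnCA.
  have e5 : (g * (D0 * m) = g * D0 * m)%N by rewrite mulnA.
  have e6 : (2 * (n0 * n0) * m = 2 * (n0 * n0 * m))%N by rewrite -!mulnA.
  have e7 : (256 * (n0 * n0) * m = 256 * (n0 * n0 * m))%N by rewrite -!mulnA.
  lia.
have h6 : (g * (M * n0) * m <= g * (2 * D0) * m)%N by rewrite !leq_mul2r leq_mul2l h1 !orbT.
have e1 : (g * M * n0 = g * (M * n0))%N by rewrite mulnA.
have e2 : (g * (2 * D0) * m = 2 * (g * D0 * m))%N by lia.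
have e3 : (512 * n0 * n0 * m = 2 * (256 * (n0 * n0) * m))%N by lia.
lia.
Qed.

End Concentration.

Section Refinement.
Variables (V : finType) (P : {set {set V}}).
Hypothesis partP : partition P [set: V].

Definition typical (d : nat) (B : {set V}) (y : V) : bool :=
  #|pblock P y| <= d * #|pblock P y :&: B|.

(** The strict majority in the second conjunct makes the cluster a function of
    the part, which is what [parts_ge] counts. *)
Definition good (C : eqType) (d : nat) (B : {set V}) (cl : V -> C) (y : V) :=
  typical d B y && (#|pblock P y :&: B|
    < 2 * #|[set y' in pblock P y :&: B | cl y' == cl y]|).

Lemma pblock_self y : y \in pblock P y.
Proof. by rewrite mem_pblock (cover_partition partP). Qed.

Lemma pblock_in y : pblock P y \in P.
Proof. by rewrite pblock_mem // (cover_partition partP). Qed.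

Lemma pblock_def Y y : Y \in P -> y \in Y -> pblock P y = Y.
Proof. exact/def_pblock/partition_trivIset/partP. Qed.

Lemma card_by_part (S : {set V}) : #|S| = \sum_(Y in P) #|Y :&: S|.
Proof.
rewrite -sum1_card (partition_big (pblock P) (mem P)) => [|y _]; last exact: pblock_in.
apply: eq_bigr => Y YP; rewrite sum1dep_card; apply: eq_card => y.
rewrite !inE andbC; congr (_ && _).
apply/eqP/idP => [<-|]; [exact: pblock_self | exact: pblock_def].
Qed.

(** A part that is atypical for [B] has more than [d] times as many vertices
    as it has in [B]; summing over disjoint parts gives the bound. *)
Lemma atypical_le d (B : {set V}) :
  d * #|[set y in B | ~~ typical d B y]| <= #|V|.
Proof.
rewrite -cardsT [#|[set: V]|]card_by_part card_by_part big_distrr /=.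
apply: leq_sum => Y YP; rewrite setIT.
have [->|/set0Pn[y]] := eqVneq (Y :&: [set y in B | ~~ typical d B y]) set0.
  by rewrite cards0 muln0.
rewrite !inE => /and3P[yY yB]; rewrite /typical (pblock_def YP yY) -ltnNge => /ltnW.
apply: leq_trans; rewrite leq_mul2l subset_leq_card ?orbT //.
by apply/subsetP => z; rewrite !inE => /and3P[-> ->].
Qed.

Section Step.
Variables (C : finType) (m s d : nat) (A B : {set V}).
Variables (q : V -> 'I_m) (cl : V -> C) (w : V -> 'I_m -> bool).

(** The pair [x, y] exhibits irregularity: the part of [y] has a large piece
    adjacent to, and another one not adjacent to, the whole cluster of [x],
    and this cluster is a large piece of the part of [x]. *)
Definition irr (g : nat) (x y : V) : bool :=
  [&& w y (q x),
      #|pblock P x| <= 2 * d * #|[set x' in pblock P x :&: A | q x' == q x]| &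
      [forall b : bool, #|pblock P y| <=
          d * g * #|[set y' in pblock P y :&: B | w y' (q x) == b]|]].

(** A bad vertex of [B] is atypical, or its part has many balanced heavy
    coordinates, or it is in the minority of its part. Each of these three
    kinds is at most [2^-11] of [B], which together is less than [2^-9]: the
    first by hypothesis, the second by the bound on irregular pairs, the third
    by [concentration]. The hypothesis on [A] leaves at most
    [m / 256] coordinates light, which is enough, so it can be as weak as the
    conclusion. *)
Lemma refine_step : 0 < m -> 0 < s ->
    (forall i, #|[set x in A | q x == i]| = s) ->
    {in B &, forall y y', cl y != cl y' ->
       m <= 64 * #|[set i | w y i != w y' i]|} ->
    2 ^ 9 * #|[set x in A | ~~ good d A q x]| <= #|A| ->
    2 ^ 11 * #|[set y in B | ~~ typical d B y]| <= #|B| ->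
    2 ^ 40 * #|[set p : V * V | [&& p.1 \in A, p.2 \in B & irr (2 ^ 20) p.1 p.2]]|
      <= #|A| * #|B| ->
  2 ^ 9 * #|[set y in B | ~~ good d B cl y]| <= #|B|.
Proof.
move=> m_gt0 s_gt0 fiber far badA atypB fewirr.
set g := (2 ^ 20)%N in fewirr.
(* numerals are unary: the large powers have to stay symbolic *)
have gE : g = 2 ^ 20 by []; clearbody g.
have E512 : 512 = 2 ^ 9 by [].
have cardA := card_uniform fiber.
pose gx i := [set x in A | (q x == i) && good d A q x].
(* at least half of the cluster [i] of [A] is good *)
pose heavy i := s <= 2 * #|gx i|.
have few_light : 256 * #|[set i | ~~ heavy i]| <= m.
  have : #|[set i | ~~ heavy i]| * s <= 2 * #|[set x in A | ~~ good d A q x]|.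
    rewrite (card_fibers q [set x in A | _]) big_distrr /= -sum1dep_card big_distrl big_mkcond /=.
    apply: leq_sum => i _; case: ifP => //; rewrite mul1n /heavy -ltnNge -(fiber i).
    rewrite -(cardsID [set x | good d A q x] [set x in A | q x == i]).
    have -> : [set x in A | q x == i] :&: [set x | good d A q x] = gx i.
      by apply/setP => x; rewrite !inE andbA.
    have -> : [set x in A | q x == i] :\: [set x | good d A q x] =
        [set x in [set x in A | ~~ good d A q x] | q x == i].
      by apply/setP => x; rewrite !inE andbA [~~ _ && _]andbC.
    by rewrite !mul2n -!addnn ltn_add2l => /ltnW ab; rewrite leq_add2r.
  move: badA; rewrite cardA; move: #|_| #|_| => a b h1 h2.
  rewrite -(leq_pmul2r s_gt0); lia.
pose hs Y := [set i | heavy i && balanced g (Y :&: B) w i].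
pose terr Y := m < 256 * #|hs Y|.
pose T := [set y in B | typical d B y && terr (pblock P y)].
(* In a part counted here each balanced heavy coordinate [i] yields irregular
   pairs: the good vertices of the cluster [i], at least [s / 2], with those
   vertices of the part whose codeword has a 1 at [i], a proportion [1 / g]. *)
have few_terr : 2 ^ 11 * #|T| <= #|B|.
  pose Irr Y := [set p : V * V | [&& p.1 \in A, p.2 \in Y :&: B & irr g p.1 p.2]].
  have part_terr Y : Y \in P -> #|A| * #|Y :&: T| <= 512 * g * #|Irr Y|.
    move=> YP; have [->|/set0Pn[y]] := eqVneq (Y :&: T) set0; first by rewrite cards0 muln0.
    rewrite !inE => /and4P[yY yB]; rewrite /typical (pblock_def YP yY) => typY terrY.
    have YT : #|Y :&: T| <= #|Y :&: B|.
      by rewrite subset_leq_card //; apply/subsetP => z; rewrite !inE => /and3P[-> ->].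
    rewrite (card_fibers (fun p => q p.1)).
    have each i : i \in hs Y ->
        s * #|Y :&: B| <= 2 * g * #|[set p in Irr Y | q p.1 == i]|.
      rewrite inE => /andP[hi /forallP spl].
      pose yi := [set y' in Y :&: B | w y' i == true].
      apply: (@leq_trans ((2 * #|gx i|) * (g * #|yi|))).
        by rewrite leq_mul // spl.
      rewrite mulnACA leq_mul2l -cardsX subset_leq_card ?orbT //.
      apply/subsetP => -[x z]; rewrite !inE /= => /andP[/and3P[xA /eqP qx gdx]].
      case/andP=> /andP[zY zB] wz; rewrite xA zY zB qx eqxx andbT /=.
      rewrite /irr qx (eqP wz) (pblock_def YP zY) /=.
      apply/andP; split.
        case/andP: gdx => typx majx; apply: leq_trans typx _.
        by rewrite -mulnA mulnCA leq_mul2l -qx (ltnW majx) orbT.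
      apply/forallP => b; apply: leq_trans typY _.
      by rewrite -mulnA leq_mul2l spl orbT.
    apply: (@leq_trans (256 * (\sum_(i in hs Y) s * #|Y :&: B|))).
      rewrite sum_nat_const cardA; move: terrY YT; rewrite /terr.
      move: #|hs Y| #|Y :&: T| #|Y :&: B| => h t b hm tb.
      rewrite -mulnA !mulnA -mulnA [X in _ <= X]mulnAC -mulnA.
      by apply: leq_mul (ltnW _) _ => //; rewrite mulnC leq_mul.
    rewrite (_ : 512 = 256 * 2) // -!mulnA leq_mul2l /= mulnA big_distrr big_mkcond /=.
    by apply: leq_sum => i _; case: ifP => // /each.
  have sumIrr : \sum_(Y in P) #|Irr Y| <=
      #|[set p : V * V | [&& p.1 \in A, p.2 \in B & irr g p.1 p.2]]|.
    rewrite -[X in _ <= X]sum1dep_card.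
    rewrite (partition_big (fun p : V * V => pblock P p.2) (mem P)) /=; last first.
      by move=> p _; apply: pblock_in.
    apply: leq_sum => Y YP; rewrite sum1dep_card subset_leq_card //.
    apply/subsetP => p; rewrite !inE => /and3P[-> /andP[pY ->] ->].
    by rewrite (pblock_def YP pY) eqxx.
  have : #|A| * #|T| <= 512 * g * \sum_(Y in P) #|Irr Y|.
    by rewrite (card_by_part T) !big_distrr /=; apply: leq_sum => Y; apply: part_terr.
  have A_gt0 : 0 < #|A| by rewrite cardA muln_gt0 m_gt0.
  move=> AT; rewrite -(leq_pmul2l A_gt0); apply: leq_trans fewirr.
  rewrite mulnCA; apply: (@leq_trans (2 ^ 11 * (512 * g * \sum_(Y in P) #|Irr Y|))).
    by rewrite leq_mul2l AT orbT.
  have -> : 2 ^ 40 = 2 ^ 11 * (512 * g).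
    rewrite gE E512 -[40]/(11 + (9 + 20)) (expnD 2 11 _) (expnD 2 9 20); exact: erefl.
  move: (2 ^ 11) => c; rewrite -[leqRHS]mulnA leq_mul2l.
  by rewrite leq_mul2l sumIrr !orbT.
pose M := [set y in B | [&& typical d B y, ~~ terr (pblock P y) &
  y \in minority (pblock P y :&: B) cl]].
(* Of the balanced coordinates, at most [m / 256] are heavy, and at most
   [m / 256] are light. *)
have few_min : 2 ^ 11 * #|M| <= #|B|.
  rewrite card_by_part [X in _ <= X]card_by_part big_distrr /=; apply: leq_sum => Y YP.
  have [->|/set0Pn[y]] := eqVneq (Y :&: M) set0; first by rewrite cards0 muln0.
  rewrite !inE => /and5P[yY yB _]; rewrite (pblock_def YP yY) => nterr _.
  have : #|Y :&: M| <= #|minority (Y :&: B) cl|.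
    rewrite subset_leq_card //; apply/subsetP => z; rewrite inE => /andP[zY].
    by rewrite inE (pblock_def YP zY) => /and4P[].
  have farY : {in Y :&: B &, forall y y', cl y != cl y' ->
       m <= 64 * #|[set i | w y i != w y' i]|}.
    by move=> z z'; rewrite !inE => /andP[_ zB] /andP[_ z'B]; apply: far.
  have few_balanced : 128 * #|[set i | balanced g (Y :&: B) w i]| <= m.
    have : #|[set i | balanced g (Y :&: B) w i]| <= #|hs Y| + #|[set i | ~~ heavy i]|.
      apply: leq_trans (leq_card_setU _ _); rewrite subset_leq_card //.
      by apply/subsetP => i; rewrite !inE => ->; rewrite andbT orbN.
    by move: nterr few_light; rewrite /terr -leqNgt; lia.
  have := concentration m_gt0 farY few_balanced.
  rewrite (_ : g = 512 * 2 ^ 11); last first.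
    by rewrite gE E512 -[20]/(9 + 11) (expnD 2 9 _); exact: erefl.
  rewrite -mulnA leq_pmul2l // => h1 h2; apply: leq_trans h1.
  by rewrite leq_mul2l h2 orbT.
have cover_bad : [set y in B | ~~ good d B cl y] \subset
    [set y in B | ~~ typical d B y] :|: T :|: M.
  apply/subsetP => y; rewrite !inE => /andP[yB]; rewrite yB /good /=.
  case: (typical d B y) => //=; case: (terr _) => //=; rewrite pblock_self /=.
  by rewrite -leqNgt.
rewrite (expnD 2 9 2) in atypB few_terr few_min.
have := leq_trans (subset_leq_card cover_bad) (leq_card_setU _ _).
have : #|[set y in B | ~~ typical d B y] :|: T|
    <= #|[set y in B | ~~ typical d B y]| + #|T| by rewrite leq_card_setU.
move: atypB few_terr few_min; move: (2 ^ 9) #|_ :|: _| => c u.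
move: #|T| #|M| #|B| => t m0 b; move: #|_| #|_| => y x h1 h2 h3 h4 h5.
have : c * y <= c * (x + t + m0) by rewrite leq_mul2l (leq_trans h5) ?leq_add2r ?h4 ?orbT.
rewrite !mulnDr; lia.
Qed.

End Step.

End Refinement.

Section CountParts.
Variables (V : finType) (P : {set {set V}}).
Hypothesis partP : partition P [set: V].
Variables (m s d : nat) (A : {set V}) (q : V -> 'I_m).

(** A part has at most one majority cluster, and all but few clusters contain
    a good vertex and so are the majority cluster of its part. *)
Lemma parts_ge : 0 < s -> (forall i, #|[set x in A | q x == i]| = s) ->
    2 ^ 9 * #|[set x in A | ~~ good P d A q x]| <= #|A| ->
  m <= 2 * #|P|.
Proof.
move=> s_gt0 fiber badA.
have cardA := card_uniform fiber.
pose major Y i := #|Y :&: A| < 2 * #|[set x in Y :&: A | q x == i]|.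
have major_uniq Y i j : major Y i -> major Y j -> i = j.
  move=> Yi Yj; apply/eqP; apply: contraT => ij; move: Yi Yj; rewrite /major.
  have : #|[set x in Y :&: A | q x == i]| + #|[set x in Y :&: A | q x == j]| <= #|Y :&: A|.
    rewrite -cardsUI (_ : [set x in _ | q x == i] :&: _ = set0) ?cards0 ?addn0; last first.
      apply/setP => x; rewrite !inE.
      by apply/negbTE/negP => /andP[/andP[_ /eqP qi] /andP[_ /eqP qj]]; rewrite -qi qj eqxx in ij.
    rewrite subset_leq_card //; apply/subsetP => x; rewrite !inE.
    by case/orP=> /andP[].
  lia.
pose f Y := [pick i | major Y i].
pose Gd := [set i | [exists x in A, good P d A q x && (q x == i)]].
have GdP : #|Gd| <= #|P|.
  rewrite -(card_imset _ (@Some_inj _)); apply: leq_trans (leq_imset_card f P).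
  apply: subset_leq_card; apply/subsetP => _ /imsetP[i + ->].
  rewrite inE => /exists_inP[x xA /andP[/andP[_ majx] /eqP qx]].
  apply/imsetP; exists (pblock P x); first exact: pblock_in.
  rewrite /f; case: pickP => [j majj|/(_ (q x))]; last by rewrite /major majx.
  by congr Some; apply: major_uniq majj; rewrite -qx.
have nGd : #|~: Gd| * s <= #|[set x in A | ~~ good P d A q x]|.
  rewrite (card_fibers q [set x in A | _]) -sum1_card big_distrl big_mkcond /=.
  apply: leq_sum => i _; case: ifP => //; rewrite mul1n !inE negb_exists_in.
  move/forall_inP => bad_i; rewrite -(fiber i) subset_leq_card //.
  apply/subsetP => x; rewrite !inE => /andP[xA qx]; rewrite xA qx andbT /=.
  by have := bad_i x xA; rewrite qx andbT.
have cGd : #|Gd| + #|~: Gd| = m by rewrite cardsC card_ord.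
move: badA; rewrite cardA => badA.
have : 2 ^ 9 * #|~: Gd| <= m.
  rewrite -(leq_pmul2r s_gt0) -mulnA; apply: leq_trans badA.
  by rewrite leq_mul2l nGd.
move: (#|~: Gd|) cGd => x cGd h.
have : 2 * x <= 2 ^ 9 * x by rewrite leq_mul2r orbT.
lia.
Qed.

End CountParts.

(** * Binary codes and block sizes *)

Section Codes.
Variable m : nat.
Notation word := {ffun 'I_m -> bool}.

Definition hamming (x y : word) := #|[set i | x i != y i]|.

Definition far_apart (S : {set word}) : bool :=
  [forall x in S, forall y in S, (x != y) ==> (m <= 64 * hamming x y)].

(** Bits are indexed by natural numbers, so that a family of codes of varying
    lengths has a simple type. *)
Definition is_code (M : nat) (c : nat -> nat -> bool) : Prop :=
  forall j j', j < M -> j' < M -> j != j' ->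
    m <= 64 * #|[set i : 'I_m | c j i != c j' i]|.

Lemma code_of_set (S : {set word}) M :
  far_apart S -> M <= #|S| -> exists c, is_code M c.
Proof.
move=> farS MS; pose x0 : word := [ffun=> false].
pose x j := nth x0 (enum S) j.
exists (fun j i => oapp (x j) false (insub i)) => j j' jM j'M jj'.
have xS l : l < M -> x l \in S.
  by move=> lM; rewrite -mem_enum mem_nth // -cardE (leq_trans lM).
move/forall_inP/(_ _ (xS j jM))/forall_inP/(_ _ (xS j' j'M)): farS.
rewrite /x nth_uniq ?enum_uniq -?cardE ?(leq_trans _ MS) // jj' /= => h.
apply: leq_trans h _; rewrite leq_mul2l; apply: subset_leq_card.
by apply/subsetP => i; rewrite !inE !valK.
Qed.

Lemma hamming_sym x y : hamming x y = hamming y x.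
Proof. by apply: eq_card => i; rewrite !inE eq_sym. Qed.

(** For short lengths distinct words are far enough apart. *)
Lemma cube_code : m <= 64 -> exists c, is_code (2 ^ m) c.
Proof.
move=> m64; apply: (@code_of_set setT); last by rewrite cardsT card_ffun card_bool card_ord.
apply/forall_inP => x _; apply/forall_inP => y _; apply/implyP => xy.
rewrite (leq_trans m64) // -{1}[64]muln1 leq_mul2l /=; apply/card_gt0P.
have [i xyi] : exists i, x i != y i.
  by apply/existsP; apply: contraNT xy => /existsPn h; apply/eqP/ffunP => i; apply/eqP/negPn.
by exists i; rewrite inE.
Qed.

Lemma sum_weights (y : word) :
  \sum_(x : word) \prod_i (if x i == y i then 2 else 1) = 3 ^ m.
Proof.
rewrite -(bigA_distr_bigA (fun i b => if b == y i then 2 else 1)) /=.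
rewrite (eq_bigr (fun=> 3)); first by rewrite prod_nat_const card_ord.
by move=> i _; rewrite big_bool; case: (y i).
Qed.

Lemma prod_weights (x y : word) :
  \prod_i (if x i == y i then 2 else 1) = 2 ^ (m - hamming x y).
Proof.
rewrite -big_mkcond /= prod_nat_const; congr (_ ^ _).
have : #|[pred i | x i == y i]| + hamming x y = m.
  rewrite -[RHS]card_ord -(cardC [pred i | x i == y i]); congr (_ + _).
  by apply: eq_card => i; rewrite !inE.
move=> eq_m; rewrite -[in RHS]eq_m addnK; apply: eq_card => i.
by rewrite !inE.
Qed.

Lemma leq_expl a b n : a <= b -> a ^ n <= b ^ n.
Proof. by case: n => // n ab; rewrite leq_exp2r. Qed.

(** Chernoff's argument: in the sum [sum_weights], equal to [3 ^ (64 * p)],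
    each word of the ball has weight at least [2 ^ (63 * p)], and [3 ^ 64] is
    less than [2 ^ 119]. *)
Lemma ball_le p (y : word) : m = 64 * p ->
  #|[set x | hamming x y < p]| * 2 ^ (63 * p) <= 2 ^ (119 * p).
Proof.
move=> mp; apply: (@leq_trans (3 ^ m)); last first.
  (* [3 ^ 5 <= 2 ^ 8] is sharp enough, up to the remainder *)
  have -> : m = 5 * (12 * p) + 4 * p by rewrite mp; lia.
  have -> : 119 * p = 8 * (12 * p) + 23 * p by lia.
  rewrite [3 ^ _]expnD [2 ^ (_ + _)]expnD; apply: leq_mul.
    by rewrite (expnM 3) (expnM 2); apply: leq_expl.
  apply: (@leq_trans (4 ^ (4 * p))); first by apply: leq_expl.
  rewrite -[4]/(2 ^ 2) -expnM leq_exp2l //; lia.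
rewrite -(sum_weights y) -sum1dep_card big_distrl big_mkcond /=.
apply: leq_sum => x _; case: ifP => // xp; rewrite mul1n prod_weights leq_exp2l //.
rewrite mp; lia.
Qed.

(** A maximal set of words that are far apart has its balls of radius [p]
    covering the whole cube. *)
Lemma gilbert_varshamov p : m = 64 * p -> 0 < p -> exists c, is_code (2 ^ (8 * p)) c.
Proof.
move=> mp p_gt0.
have [S /maxsetP[farS maxS] _] : {S | maxset far_apart S & set0 \subset S}.
  by apply: maxset_exists; apply/forall_inP => x; rewrite inE.
apply: (code_of_set farS).
have covers : setT \subset \bigcup_(y in S) [set x | hamming x y < p].
  apply/subsetP => x _; apply/bigcupP; apply/exists_inP.
  apply: contraT; rewrite negb_exists_in => /forall_inP xfar.
  have xS : x \notin S.
    apply/negP => /xfar; rewrite inE /hamming (_ : #|_| = 0) ?p_gt0 //.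
    by apply: eq_card0 => i; rewrite !inE eqxx.
  have {}xfar y : y \in S -> m <= 64 * hamming x y.
    by move=> /xfar; rewrite inE -leqNgt mp leq_mul2l.
  have /maxS/(_ (subsetUr _ _)) : far_apart (x |: S).
    apply/forall_inP => y; rewrite !inE => /orP[/eqP->|yS]; apply/forall_inP => z;
      rewrite !inE => /orP[/eqP->|zS]; apply/implyP => yz.
    - by rewrite eqxx in yz.
    - exact: xfar.
    - by rewrite hamming_sym xfar.
    by move/forall_inP/(_ _ yS)/forall_inP/(_ _ zS)/implyP: farS; apply.
  by move=> eqS; rewrite -eqS setU11 in xS.
have : 2 ^ m <= \sum_(y in S) #|[set x | hamming x y < p]|.
  have -> : 2 ^ m = #|[set: word]| by rewrite cardsT card_ffun card_bool card_ord.
  apply: leq_trans (subset_leq_card covers) _.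
  elim/big_ind2: _ => [|A a B b h1 h2|//]; rewrite ?cards0 //.
  by rewrite (leq_trans (leq_card_setU _ _)) ?leq_add.
rewrite -(leq_pmul2r (expn_gt0 2 (63 * p))) => h.
have : 2 ^ m * 2 ^ (63 * p) <= #|S| * 2 ^ (119 * p).
  apply: leq_trans h _; rewrite big_distrl -sum_nat_const /=.
  by apply: leq_sum => y _; apply: ball_le.
rewrite -expnD (_ : m + 63 * p = 8 * p + 119 * p); last by rewrite mp; lia.
by rewrite expnD leq_pmul2r ?expn_gt0.
Qed.

End Codes.

(** The full cube serves for the sizes 1, 2, 4 and 16. All later sizes are
    multiples of 64, as [gilbert_varshamov] requires, and large enough to grow
    in spite of the rate 1/8. *)
Definition next_size (m : nat) : nat := if m <= 16 then 2 ^ m else 2 ^ (m %/ 8).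

Definition msize (r : nat) : nat := iter r next_size 1.
Arguments msize : simpl never.

Lemma twr_gt0 n : 0 < twr n.
Proof. by case: n => //= n; rewrite expn_gt0. Qed.

(** The factor [2 ^ 10] makes up for the rate 1/8 at each step. *)
Lemma msize_growth n : (64 %| msize n.+4) && (2 ^ 10 * twr n <= msize n.+4).
Proof.
elim: n => [|n /andP[_ IHn]].
  have -> : msize 4 = 2 ^ 16 by rewrite /msize iterS (_ : iter 3 next_size 1 = 16).
  by rewrite -[64]/(2 ^ 6) dvdn_exp2l // muln1 leq_exp2l.
have t0 := twr_gt0 n.
have m_big : 2 ^ 10 * 1 <= msize n.+4 by apply: leq_trans IHn; rewrite leq_mul2l t0 orbT.
have -> : msize n.+4.+1 = 2 ^ (msize n.+4 %/ 8).
  rewrite [LHS]iterS -/(msize n.+4) /next_size ifN // -ltnNge.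
  by apply: leq_trans m_big.
have e_big : 10 + twr n <= msize n.+4 %/ 8.
  rewrite leq_divRL //; apply: leq_trans IHn.
  rewrite -[2 ^ 10]/(128 * 8); lia.
have e6 : 6 <= msize n.+4 %/ 8 by apply: leq_trans e_big.
rewrite -[64]/(2 ^ 6) (dvdn_exp2l 2 e6) [twr n.+1]/(2 ^ twr n) -expnD.
by rewrite leq_exp2l.
Qed.

Lemma msize_code r : exists c, is_code (msize r) (msize r.+1) c.
Proof.
rewrite [msize r.+1]iterS -/(msize r) /next_size.
case: leqP => [m16|m16]; first by apply: cube_code; apply: leq_trans m16 _.
have /dvdnP[p mp] : 64 %| msize r.
  by case: r m16 => [|[|[|[|n]]]] // _; case/andP: (msize_growth n).
have -> : msize r %/ 8 = 8 * p by rewrite mp -[64]/(8 * 8) mulnA mulnK // mulnC.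
apply: gilbert_varshamov; first by rewrite mp mulnC.
by rewrite lt0n; apply: contraTneq m16 => p0; rewrite mp p0.
Qed.

Lemma msize_gt0 r : 0 < msize r.
Proof.
case: r => // r; rewrite [msize r.+1]iterS /next_size.
by case: ifP; rewrite expn_gt0.
Qed.

(** * The chain of blocks *)

Lemma card_residue (n m s : nat) (i : 'I_m) : n = m * s ->
  #|[set x : 'I_n | x %% m == i]| = s.
Proof.
move=> n_ms; have m_gt0 : 0 < m by apply: leq_ltn_trans (ltn_ord i).
have lt_h (j : 'I_s) : j * m + i < n.
  by have := ltn_ord j; have := ltn_ord i; rewrite n_ms; nia.
rewrite -[RHS]card_ord -(card_imset (f := fun j => Ordinal (lt_h j)) predT); last first.
  by move=> j j' [] /eqP; rewrite eqn_add2r eqn_pmul2r // => /eqP/val_inj.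
apply: eq_card => x; rewrite !inE; apply/eqP/imsetP => [xi|[j _ ->]].
  have x_lt : x %/ m < s by rewrite ltn_divLR // mulnC -n_ms.
  by exists (Ordinal x_lt) => //; apply: val_inj; rewrite /= {1}(divn_eq x m) xi.
by rewrite /= modnMDl modn_small.
Qed.

Section ChainGraph.
Variables (k : nat) (i0 i1 : 'I_k) (L : nat) (c : nat -> nat -> nat -> bool).
Hypothesis i01 : i0 != i1.

(** A multiple of all [msize r], so that residues cut a block into equal
    clusters. *)
Definition bsize : nat := \prod_(r < L.+1) msize r.

(** A vertex is a class, a block and a position in the block. Every class has
    vertices for all blocks, so that all classes have one size. There are two
    chains, one for each order of [i0] and [i1]; the proof follows the one with block
    [r] in the class [side r]. *)
Definition vtx : finType := ('I_k * ('I_L.+1 * 'I_bsize))%type.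

Definition link (b b' : 'I_L.+1 * 'I_bsize) : bool :=
  (b'.1 == b.1.+1 :> nat) && c b.1 (b'.2 %% msize b'.1) (b.2 %% msize b.1).

Definition chain_adj : rel vtx := fun u v =>
  (u.1 != v.1) &&
  (([set u.1; v.1] == [set i0; i1]) ==> (link u.2 v.2 || link v.2 u.2)).

Lemma chain_adj_sym : symmetric chain_adj.
Proof. by move=> u v; rewrite /chain_adj eq_sym setUC orbC. Qed.

Lemma chain_adj_irr : irreflexive chain_adj.
Proof. by move=> u; rewrite /chain_adj eqxx. Qed.

Lemma chain_classP (u v : vtx) :
  SGraph chain_adj_sym chain_adj_irr u v -> u.1 != v.1.
Proof. by case/andP. Qed.

Definition chain_graph : kpartite k vtx :=
  @KPartite k _ (SGraph chain_adj_sym chain_adj_irr) (fun u => u.1) chain_classP.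

Definition side (r : nat) : 'I_k := if odd r then i1 else i0.

Definition block (r : nat) : {set vtx} :=
  [set v : vtx | (v.1 == side r) && (v.2.1 == r :> nat)].

Definition cluster (r : nat) (v : vtx) : 'I_(msize r) :=
  Ordinal (ltn_pmod v.2.2 (msize_gt0 r)).

Definition codeword (r : nat) (v : vtx) (i : 'I_(msize r)) : bool :=
  c r (v.2.2 %% msize r.+1) i.

Lemma side_neq r : side r != side r.+1.
Proof. by rewrite /side /=; case: odd; rewrite // eq_sym. Qed.

Lemma side_pair r : [set side r; side r.+1] = [set i0; i1].
Proof. by rewrite /side /=; case: odd => //=; rewrite setUC. Qed.

Lemma bsize_gt0 : 0 < bsize.
Proof. by apply: prodn_gt0 => r; apply: msize_gt0. Qed.

Lemma bsize_div r : r <= L -> bsize = msize r * (bsize %/ msize r).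
Proof.
rewrite -ltnS => rL; rewrite /bsize (bigD1 (Ordinal rL)) //= mulKn ?msize_gt0 //.
Qed.

Lemma card_cluster r (i : 'I_(msize r)) : r <= L ->
  #|[set v in block r | cluster r v == i]| = bsize %/ msize r.
Proof.
move=> rL; rewrite -(card_residue i (bsize_div rL)).
rewrite -(card_imset (f := fun x : 'I_bsize =>
   (side r, (Ordinal (rL : r < L.+1), x)) : vtx)); last by move=> x y [].
apply: eq_card => -[j [r' x]]; rewrite !inE /=; apply/idP/imsetP.
  case/andP=> /andP[/eqP-> /eqP r'r] xi; exists x; first by rewrite inE.
  by congr (_, (_, _)); apply: val_inj.
by case=> y; rewrite inE => yi [-> -> ->]; rewrite !eqxx.
Qed.

Lemma card_block r : r <= L -> #|block r| = bsize.
Proof.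
move=> rL; rewrite (card_uniform (fun i : 'I_(msize r) => card_cluster i rL)).
by rewrite -bsize_div.
Qed.

Lemma card_class (i : 'I_k) : #|[set v : vtx | v.1 == i]| = L.+1 * bsize.
Proof.
rewrite -[in RHS](card_ord L.+1) -[in RHS](card_ord bsize) -card_prod.
rewrite -(card_imset (f := fun b => (i, b) : vtx)); last by move=> x y [].
apply: eq_card => -[j b]; rewrite inE /=; apply/eqP/imsetP => [->|[b' _ [-> _]//]].
by exists b.
Qed.

(** The tests of irregularity: a cluster [i] of one block, and in the next
    block the vertices whose codeword has bit [b] at [i]; all of the vertices
    in the other classes. The graph is complete between those two sets or has
    no edge there, according to [b]. *)
Definition testset (r : nat) (i : 'I_(msize r)) (b : bool) : {set vtx} :=
  [set v : vtx | [|| v.1 \notin [set i0; i1],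
      (v \in block r) && (cluster r v == i) |
      (v \in block r.+1) && (codeword v i == b)]].

Lemma testset_blowup r (i : 'I_(msize r)) b :
  {in testset i b &, forall u v, chain_graph u v =
     (vclass chain_graph u != vclass chain_graph v) &&
     (b || ([set vclass chain_graph u; vclass chain_graph v] != [set i0; i1]))}.
Proof.
move=> u v; rewrite !inE /= /chain_adj => uD vD; case uv: (u.1 != v.1) => //=.
case e01: (_ == _) => /=; last by rewrite orbT.
rewrite orbF.
have uv01 : (u.1 \in [set i0; i1]) && (v.1 \in [set i0; i1]).
  by rewrite -(eqP e01) !inE !eqxx orbT.
have linkE x y : (x \in block r) && (cluster r x == i) ->
    (y \in block r.+1) && (codeword y i == b) -> link x.2 y.2 || link y.2 x.2 = b.
  rewrite !inE => /andP[/andP[_ /eqP xr] /eqP xi] /andP[/andP[_ /eqP yr] /eqP wb].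
  have -> : link y.2 x.2 = false.
    by rewrite /link xr yr eqn_leq [_.+2 <= _]ltnNge leqnSn andbF.
  by rewrite orbF /link yr xr eqxx -wb -xi.
move: uv01 uD vD; rewrite !inE => /andP[-> ->] /=.
case/orP=> hu /orP[] hv.
- case/negP: uv; case/andP: hu => /andP[/eqP-> _] _.
  by case/andP: hv => /andP[/eqP-> _] _.
- by apply: linkE; rewrite !inE.
- by rewrite orbC; apply: linkE; rewrite !inE.
case/negP: uv; case/andP: hu => /andP[/eqP-> _] _.
by case/andP: hv => /andP[/eqP-> _] _.
Qed.

End ChainGraph.

(** * Irregular pairs of vertices produce irregular copies *)

Section Irregularity.
Variables (R : realType) (k : nat) (T : finType) (F H : sgraph T) (eps : R).
Variables (i0 i1 : 'I_k) (L : nat) (c : nat -> nat -> nat -> bool) (g d : nat).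
Hypothesis i01 : i0 != i1.
Hypothesis card_T : #|T| = k.
Hypothesis sep : #|avoiding H [set i0; i1]| * #|placements 'I_k F|
  < #|placements 'I_k H| * #|avoiding F [set i0; i1]|.

Let G := chain_graph i0 i1 L c.
Let V := vtx k L.
Let blk := @block k i0 i1 L.
Let class_ (j : 'I_k) : {set V} := [set v : V | v.1 == j].

Variable P : {set {set V}}.
Hypothesis partP : partition P [set: V].

Definition irr_pair (r : nat) (x y : V) : bool :=
  [&& x \in blk r, y \in blk r.+1 &
    irr P d (blk r) (blk r.+1) (@cluster k L r) (@codeword k L c r) g x y].

(** In the classes other than [i0] and [i1] the loss [2 * k] may not depend on
    the number of blocks, since it is raised to the power [k] in
    [irr_factors]. *)
Definition typical_class (j : 'I_k) (v : V) : bool :=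
  (v.1 == j) && ((j \notin [set i0; i1]) ==> typical P (2 * k) (class_ j) v).

Definition irr_transversal (r : nat) (x y : V) (t : {ffun 'I_k -> V}) : bool :=
  [&& t (side i0 i1 r) == x, t (side i0 i1 r.+1) == y &
    [forall j, typical_class j (t j)]].

(** The test sets keep enough of the parts: all vertices of the right class for
    the typical coordinates, and what [irr] guarantees for [x] and [y]. *)
Lemma irr_factors r x y t b : irr_pair r x y -> irr_transversal r x y t ->
  \prod_j #|pblock P (t j)| <= (2 * k) ^ k * (2 * d * (d * g)) *
    \prod_j #|[set v in pblock P (t j) :&: testset i0 i1 L c (cluster r x) b | v.1 == j]|.
Proof.
move=> irrp irrt.
case/and3P: irrp => xb yb /and3P[_ irrx /forallP irry].
case/and3P: irrt => /eqP tx /eqP ty /forallP tP.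
set a0 := side i0 i1 r in tx *; set a1 := side i0 i1 r.+1 in ty *.
have a01 : [set a0; a1] = [set i0; i1] by apply: side_pair.
have na01 : a0 != a1 by apply: side_neq.
have k0 : 0 < k by case: (k) i0 => // -[].
pose f0 j := if j == a0 then 2 * d else 1.
pose f1 j := if j == a1 then d * g else 1.
pose n j := #|[set v in pblock P (t j) :&: testset i0 i1 L c (cluster r x) b | v.1 == j]|.
have : \prod_j #|pblock P (t j)| <= \prod_(j < k) (2 * k * (f0 j * f1 j) * n j).
  apply: leq_prod => j _; have := tP j; rewrite /typical_class -a01 !inE /f0 /f1.
  have [-> _|ja0] := eqVneq j a0.
    rewrite (negPf na01) tx muln1; apply: leq_trans irrx _.
    apply: leq_mul; first by rewrite leq_pmull // muln_gt0.
    rewrite /n tx; apply: subset_leq_card; apply/subsetP => v.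
    rewrite [v \in [set _ in _ | _]]inE in_setI => /andP[/andP[vx vb] vc].
    rewrite inE in_setI vx inE vb vc orbT /=.
    by move: vb; rewrite inE => /andP[].
  have [-> _|ja1] := eqVneq j a1.
    rewrite ty mul1n; apply: leq_trans (irry b) _.
    apply: leq_mul; first by rewrite leq_pmull // muln_gt0.
    rewrite /n ty; apply: subset_leq_card; apply/subsetP => v.
    rewrite [v \in [set _ in _ | _]]inE in_setI => /andP[/andP[vx vb] vc].
    rewrite inE in_setI vx inE vb vc !orbT /=.
    by move: vb; rewrite inE => /andP[].
  move=> /andP[_ /= typ]; rewrite !muln1; apply: leq_trans typ _.
  rewrite leq_mul2l; apply/orP; right.
  apply: subset_leq_card; apply/subsetP => v.
  rewrite in_setI !inE => /andP[-> /eqP ->]; rewrite eqxx andbT /=.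
  by rewrite -in_set2 -a01 !inE negb_or ja0 ja1.
move=> /leq_trans; apply; rewrite !big_split /= !prod_nat_const card_ord -expnMn.
rewrite /f0 /f1 -!big_mkcond !big_pred1_eq; exact: leqnn.
Qed.

(** [1 / eps_inv] is the threshold below which every test set used in
    [irr_copy] is large enough to be decisive. *)
Definition eps_inv : nat := k ^ k * ((2 * k) ^ k * (2 * d * (d * g))).

Hypothesis eps_ge0 : (0 <= eps)%R.
Hypothesis eps_small : (eps * eps_inv%:R <= 1)%R.
Hypothesis eps_gap : (eps * (2 * (k ^ k) ^ 2)%:R < 1)%R.

(** Whatever the order in which the parts of [X] are listed, they are the parts
    of the vertices of the transversal, up to the permutation [s]. *)
Lemma irr_copy r x y t (S : {set V} * {set {set V}}) :
    irr_pair r x y -> irr_transversal r x y t -> S.1 = [set t j | j : 'I_k] ->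
  ~~ in_regular_parts eps H F G P S.
Proof.
move=> irrp irrt defS; apply/existsPn => X; apply/negP.
case/and3P=> /forallP XP reg /existsP[v /and3P[/injectiveP vI /eqP Sv /forallP vX]].
have tP j : (t j).1 = j.
  by case/and3P: irrt => _ _ /forallP/(_ j)/andP[/eqP].
pose s i := (v i).1.
have vt i : v i = t (s i).
  have : v i \in [set t j | j : 'I_k] by rewrite -defS Sv imset_f.
  by case/imsetP=> j _ vij; rewrite /s vij tP.
have sI : injective s by move=> i j sij; apply: vI; rewrite !vt sij.
have XE i : X i = pblock P (t (s i)).
  by apply/esym/(pblock_def partP (XP i)); rewrite -vt.
pose n b j := #|[set v in pblock P (t j) :&: testset i0 i1 L c (cluster r x) b | v.1 == j]|.
have nE b : \prod_i #|[set v in X i :&: testset i0 i1 L c (cluster r x) b | vclass G v == s i]|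
    = \prod_j n b j.
  by rewrite [RHS](reindex_inj sI); apply: eq_bigr => i _; rewrite XE.
have XprodE : \prod_i #|X i| = \prod_j #|pblock P (t j)|.
  by rewrite [RHS](reindex_inj sI); apply: eq_bigr => i _; rewrite XE.
have factors b := irr_factors b irrp irrt.
move: reg; apply/negP.
apply: (@irregular_tuple R k T V eps H F G X card_T _ s (testset i0 i1 L c (cluster r x))
  sI sep _ eps_gap eps_ge0) => b.
- exact: testset_blowup.
-   rewrite nE XprodE natrM mulrA.
  have : (eps * (k ^ k * \prod_j #|pblock P (t j)|)%:R
     <= eps * (eps_inv * \prod_j n b j)%:R)%R.
    by rewrite ler_wpM2l // ler_nat -mulnA leq_mul2l factors orbT.
  rewrite -mulrA -natrM => /le_trans; apply.
  by rewrite natrM mulrA ler_piMl.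
- rewrite nE; have := factors b; rewrite -/(n b).
have : 0 < \prod_j #|pblock P (t j)|.
  by apply: prodn_gt0 => j; apply/card_gt0P; exists (t j); apply: pblock_self.
by move=> /leq_trans h /h; rewrite muln_gt0 => /andP[].
Qed.

(** For typicality with loss [2 * k] at least half of each class is available,
    all classes having the same size. *)
Lemma card_irr_transversals r x y : irr_pair r x y -> r < L ->
  (L.+1 * bsize L) ^ k <=
  (L.+1 * bsize L) ^ 2 * (2 ^ k * #|[set t | irr_transversal r x y t]|).
Proof.
move=> irrp rL; set M := L.+1 * bsize L.
set a0 := side i0 i1 r; set a1 := side i0 i1 r.+1.
have a01 : [set a0; a1] = [set i0; i1] by apply: side_pair.
have na01 : a0 != a1 by apply: side_neq.
pose U j : {set V} := if j == a0 then [set x] else if j == a1 then [set y] else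
  [set v in class_ j | typical P (2 * k) (class_ j) v].
have -> : #|[set t | irr_transversal r x y t]| = \prod_j #|U j|.
  transitivity #|family (fun j => mem (U j))|; last first.
    by rewrite card_family foldrE big_map big_enum.
  apply: eq_card => t; rewrite inE; apply/and3P/familyP.
    case=> /eqP tx /eqP ty /forallP tP j; rewrite /U.
    have [->|ja0] := eqVneq j a0; first by rewrite tx !inE.
    have [->|ja1] := eqVneq j a1; first by rewrite ty !inE.
    have /andP[tj1 /implyP typ] := tP j; rewrite inE [t j \in class_ j]inE tj1 typ //.
    by rewrite -a01 !inE negb_or ja0 ja1.
  move=> tU; have tx : t a0 = x by have := tU a0; rewrite /U eqxx !inE => /eqP.
  have ty : t a1 = y by have := tU a1; rewrite /U eq_sym (negPf na01) eqxx !inE => /eqP.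
  have [xb yb _] := and3P irrp; rewrite -/a0 -/a1 tx ty !eqxx; split=> //.
  apply/forallP => j; rewrite /typical_class -a01 !inE; have := tU j; rewrite /U.
  have [->|ja0] := eqVneq j a0.
    by rewrite tx => _; move: xb; rewrite inE => /andP[->].
  have [->|ja1] := eqVneq j a1.
    by rewrite ty => _; move: yb; rewrite inE => /andP[-> _].
  by rewrite inE [t j \in class_ j]inE.
have big_class j : j != a0 -> j != a1 -> M <= 2 * #|U j|.
  move=> ja0 ja1; rewrite /U (negPf ja0) (negPf ja1).
  have cM : #|class_ j| = M by apply: card_class.
  have atyp := atypical_le partP (2 * k) (class_ j).
  have cV : #|V| = k * M by rewrite card_prod card_ord card_prod !card_ord.
  have k0 : 0 < k by case: (k) i0 => // -[].
  have : 2 * #|[set v in class_ j | ~~ typical P (2 * k) (class_ j) v]| <= M.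
    by rewrite -(leq_pmul2l k0) -cV mulnA [k * 2]mulnC.
  have : #|class_ j| <= #|[set v in class_ j | typical P (2 * k) (class_ j) v]|
     + #|[set v in class_ j | ~~ typical P (2 * k) (class_ j) v]|.
    apply: leq_trans (leq_card_setU _ _); rewrite subset_leq_card //.
    by apply/subsetP => v; rewrite !inE => ->; rewrite orbN.
  rewrite cM; lia.
pose f0 j := if j == a0 then M else 1; pose f1 j := if j == a1 then M else 1.
have : \prod_(j < k) M <= \prod_(j < k) (f0 j * f1 j * (2 * #|U j|)).
  apply: leq_prod => j _; rewrite /f0 /f1.
  have [ja0|ja0] := eqVneq j a0.
    by rewrite /U ja0 eqxx (negPf na01) cards1 !muln1 leq_pmulr.
  have [ja1|ja1] := eqVneq j a1; last by rewrite mul1n mul1n big_class.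
  by rewrite /U ja1 eq_sym (negPf na01) eqxx cards1 mul1n muln1 leq_pmulr.
rewrite prod_nat_const card_ord => /leq_trans; apply.
rewrite !big_split /= prod_nat_const card_ord /f0 /f1 -!big_mkcond !big_pred1_eq /=.
exact: leqnn.
Qed.

(** Each of these transversals spans a complete graph, as the pair [x], [y] is
    an edge, so one fixed placement of [H] gives one irregular copy on it. *)
Lemma irr_transversals_le r : regular_partition eps H F G P ->
  eps_inv * #|[set t : {ffun 'I_k -> V} |
      irr_pair r (t (side i0 i1 r)) (t (side i0 i1 r.+1)) &&
      [forall j, typical_class j (t j)]]|
    <= (L.+1 * bsize L) ^ k * k ^ k.
Proof.
case=> _; set Bad := [set S in _ | _] => few_bad; set Tr := [set t | _].
have card_TI : #|T| = #|'I_k| by rewrite card_ord.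
have cl_class (u v : V) : (u.1 == v.1) = (vclass G u == vclass G v) by [].
have [E0 E0H] : exists E0, E0 \in placements 'I_k H.
  by apply/card_gt0P; apply: placements_gt0.
pose h (t : {ffun 'I_k -> V}) := placed_copy (t, E0).
have Tr_transv t : t \in Tr -> t \in transversals (fun u : V => u.1).
  by rewrite inE => /andP[_ /forallP tP]; apply/transversalsP => j;
     have /andP[/eqP] := tP j.
have TrBad : h @: Tr \subset Bad.
  apply/subsetP => _ /imsetP[t tTr ->]; have tT := Tr_transv t tTr.
  move: (tTr); rewrite inE => /andP[irrp tP].
  have irrt : irr_transversal r (t (side i0 i1 r)) (t (side i0 i1 r.+1)) t.
    by rewrite /irr_transversal !eqxx.
  rewrite inE; apply/andP; split; last first.
    by apply: (irr_copy irrp irrt).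
  rewrite (copies_placed cl_class card_TI); apply: imset_f; rewrite inE /= tT E0H /=.
  apply/subsetP => _ /imsetP[e eE ->].
  have [i [j [ij ->]]] := placement_edge E0H eE.
  have test l : t l \in testset i0 i1 L c (cluster r (t (side i0 i1 r))) true.
    have /transversalsP/(_ l) tl := tT.
    have [lin|lnin] := boolP (l \in [set i0; i1]); last by rewrite inE tl lnin.
    have /and3P[xb yb /and3P[wxy _ _]] := irrp.
    move: lin; rewrite -(side_pair i0 i1 r) inE !in_set1 => /orP[]/eqP->.
      by rewrite inE xb eqxx orbT.
    by rewrite inE yb wxy !orbT.
  rewrite imset_pair mem_edges (testset_blowup (test i) (test j)) andbT.
  by rewrite /= !(transversalsP _ _ tT).
have cTr : #|Tr| <= #|Bad|.
  rewrite -(card_in_imset (f := h)) ?subset_leq_card // => t t' tT t'T.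
  have ht : (t, E0) \in [pred p | p.1 \in transversals (fun u : V => u.1)] by apply: Tr_transv.
  have ht' : (t', E0) \in [pred p | p.1 \in transversals (fun u : V => u.1)] by apply: Tr_transv.
  by case/(placed_copy_inj ht ht').
have ncH : ncopies H G <= (L.+1 * bsize L) ^ k * k ^ k.
  apply: leq_trans (ncopies_le cl_class card_TI H) _.
  apply: leq_mul; last by have := placements_le H card_TI; rewrite card_ord.
  rewrite (eq_bigr (fun=> L.+1 * bsize L)) ?prod_nat_const ?card_ord // => j _.
  exact: card_class.
apply: leq_trans (_ : eps_inv * #|Bad| <= _); first by rewrite leq_mul2l cTr orbT.
apply: leq_trans ncH.
rewrite -(ler_nat R) natrM; apply: le_trans (ler_wpM2l (ler0n _ _) few_bad) _.
by rewrite mulrA [(_ * eps)%R]mulrC ler_piMl.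
Qed.

Lemma few_irr_pairs r : r < L -> regular_partition eps H F G P ->
  eps_inv * #|[set p : V * V | irr_pair r p.1 p.2]| <=
     (L.+1 * bsize L) ^ 2 * (2 * k) ^ k.
Proof.
move=> rL /irr_transversals_le - /(_ r); set M := L.+1 * bsize L.
set Tr := [set t | _]; set IP := [set p | _] => TrM.
have M_gt0 : 0 < M by rewrite muln_gt0 bsize_gt0.
have : #|IP| * M ^ k <= M ^ 2 * (2 ^ k * #|Tr|).
  rewrite (card_fibers (fun t : {ffun 'I_k -> V} => (t (side i0 i1 r), t (side i0 i1 r.+1))) Tr).
  rewrite !big_distrr -sum_nat_const big_mkcond /=; apply: leq_sum => -[x y] _.
  case: ifP => //; rewrite inE => irrp; apply: leq_trans (card_irr_transversals irrp rL) _.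
  rewrite !leq_mul2l subset_leq_card ?orbT //; apply/subsetP => t.
  rewrite !inE => /and3P[/eqP tx /eqP ty ->]; rewrite tx ty andbT eqxx andbT.
  exact: irrp.
move=> IPM; rewrite -(leq_pmul2r (_ : 0 < M ^ k)) ?expn_gt0 ?M_gt0 //.
rewrite -mulnA; apply: leq_trans (leq_mul (leqnn eps_inv) IPM) _.
rewrite mulnCA -mulnA leq_mul2l; apply/orP; right.
by rewrite mulnCA expnMn -mulnA leq_mul2l [k ^ k * _]mulnC TrM orbT.
Qed.

End Irregularity.

(** * The number of parts *)

Lemma irr_budget k l b I : 0 < k -> 0 < l ->
    eps_inv k (2 ^ 20) (2 ^ 11 * (k * l)) * I <= (l * b) ^ 2 * (2 * k) ^ k ->
  2 ^ 40 * I <= b * b.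
Proof.
move=> k0 l0; rewrite /eps_inv.
have -> : 2 * (2 ^ 11 * (k * l)) * (2 ^ 11 * (k * l) * 2 ^ 20)
    = 2 ^ 40 * (2 ^ 2 * 2) * (l ^ 2 * k ^ 2).
  rewrite -[40]/(11 + (11 + 18)) -[20]/(18 + 2) !(expnD 2 _ _) !(expnSr _ 1) !expn1.
  move: (2 ^ 11) (2 ^ 18) => x y; lia.
move: (2 ^ 40) => x h.
have K0 : 0 < l ^ 2 * (2 * k) ^ k by rewrite !muln_gt0 !expn_gt0 muln_gt0 k0 l0.
rewrite -(leq_pmul2r K0); apply: leq_trans (_ : b * b * (l ^ 2 * (2 * k) ^ k) <= _) => //.
apply: leq_trans (leq_trans _ h) _; last first.
  by rewrite expnMn -mulnn; apply: eq_leq; lia.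
have f0 : 0 < k ^ k * (2 ^ 2 * 2) * k ^ 2 by rewrite !muln_gt0 !expn_gt0 k0.
move: (k ^ k) (2 ^ 2 * 2) (k ^ 2) ((2 * k) ^ k) (l ^ 2) f0 => a b' c' d' e' f0.
apply: leq_trans (leq_pmulr _ f0) _; apply: eq_leq; lia.
Qed.

Section ManyParts.
Variables (R : realType) (k : nat) (T : finType) (F H : sgraph T) (eps : R).
Variables (i0 i1 : 'I_k) (L : nat) (c : nat -> nat -> nat -> bool).
Hypothesis i01 : i0 != i1.
Hypothesis card_T : #|T| = k.
Hypothesis sep : #|avoiding H [set i0; i1]| * #|placements 'I_k F|
  < #|placements 'I_k H| * #|avoiding F [set i0; i1]|.
Hypothesis codes : forall r, is_code (msize r) (msize r.+1) (c r).

Let G := chain_graph i0 i1 L c.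
Let d := 2 ^ 11 * (k * L.+1).

Hypothesis eps_ge0 : (0 <= eps)%R.
Hypothesis eps_small : (eps * (eps_inv k (2 ^ 20) d)%:R <= 1)%R.
Hypothesis eps_gap : (eps * (2 * (k ^ k) ^ 2)%:R < 1)%R.

Variable P : {set {set vtx k L}}.
Hypothesis regP : regular_partition eps H F G P.

(** Block 0 is a single cluster, where typical vertices are good. *)
Lemma blocks_refined r : r <= L ->
  2 ^ 9 * #|[set v in block i0 i1 L r |
      ~~ good P d (block i0 i1 L r) (@cluster k L r) v]|
    <= #|block i0 i1 L r|.
Proof.
have partP : partition P [set: vtx k L] by case: regP.
have k0 : 0 < k by case: (k) i0 => // -[].
have atyp j : j <= L ->
    2 ^ 11 * #|[set v in block i0 i1 L j | ~~ typical P d (block i0 i1 L j) v]|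
      <= #|block i0 i1 L j|.
  move=> jL; have kL : 0 < k * L.+1 by rewrite muln_gt0 k0.
  rewrite card_block // -(leq_pmul2l kL) mulnA [k * L.+1 * _]mulnC.
  apply: leq_trans (atypical_le partP d _) _.
  by rewrite card_prod card_ord card_prod !card_ord mulnA.
elim: r => [|r IHr] rL.
  apply: leq_trans (atyp 0 rL); apply: leq_mul; first by rewrite leq_exp2l.
  apply: subset_leq_card; apply/subsetP => v; rewrite inE => /andP[vb].
  rewrite inE vb /good; case: typical => //=.
  have -> : [set v' in pblock P v :&: block i0 i1 L 0 | cluster 0 v' == cluster 0 v]
      = pblock P v :&: block i0 i1 L 0.
    apply/setP => v'; rewrite !inE (_ : cluster 0 v' == _) ?andbT //.
    by apply/eqP/val_inj; rewrite /= !modn1.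
  rewrite mul2n -addnn -[X in X < _]addn0 ltn_add2l => /negP[].
  by apply/card_gt0P; exists v; rewrite inE vb pblock_self.
have rL' := ltnW rL.
have s_gt0 : 0 < bsize L %/ msize r.
  by have := bsize_gt0 L; rewrite {1}(bsize_div rL') muln_gt0 => /andP[].
apply: (@refine_step _ _ partP _ (msize r) (bsize L %/ msize r) d (block i0 i1 L r) _
  (@cluster k L r) _ (@codeword k L c r)) => //.
- exact: msize_gt0.
- by move=> i; apply: card_cluster.
- move=> y y' _ _ yy'; apply: codes; rewrite ?ltn_pmod ?msize_gt0 //.
- exact: IHr.
- exact: atyp.
have := few_irr_pairs i01 card_T sep partP eps_ge0 eps_small eps_gap rL regP.
rewrite !card_block //; exact: irr_budget.
Qed.

End ManyParts.

(** All factors are absorbed by powers of [k ^ k], which is at least 4, except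
    for the square of the number of blocks. *)
Lemma scale_budget k n : 1 < k -> 0 < n ->
  eps_inv k (2 ^ 20) (2 ^ 11 * (k * n.+4.+1)) <= n ^ 2 * (k ^ k) ^ 100.
Proof.
move=> k1 n0; set K := k ^ k.
have k0 := ltnW k1.
have kK : k <= K by rewrite -{1}[k]expn1 leq_exp2l.
have K4 : 4 <= K.
  by apply: (@leq_trans (k ^ 2)); [rewrite (leq_exp2r 2 k (isT : 0 < 2)) | rewrite leq_exp2l].
have K2k : 2 ^ k <= K by rewrite leq_exp2r.
have nle : n.+4.+1 <= 2 ^ 3 * n by lia.
have d_le : 2 ^ 11 * (k * n.+4.+1) <= 2 ^ 14 * (K * n).
  rewrite -[14]/(11 + 3) expnD -mulnA leq_mul2l; apply/orP; right.
  by rewrite mulnCA; apply: leq_mul.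
have p50 : 2 ^ 49 <= K ^ 25.
  apply: (@leq_trans (2 ^ (2 * 25))); first by rewrite leq_exp2l.
  by rewrite expnM; apply: leq_expl.
apply: (@leq_trans (K * (K * K * (2 * (2 ^ 14 * (K * n)) * (2 ^ 14 * (K * n) * 2 ^ 20))))).
  rewrite /eps_inv -/K leq_mul2l; apply/orP; right.
  apply: leq_mul; first by rewrite expnMn leq_mul.
  by apply: leq_mul; [rewrite leq_mul2l d_le | rewrite leq_mul2r d_le orbT].
apply: (@leq_trans (n ^ 2 * (K ^ 25 * K ^ 5))).
  have -> : K * (K * K * (2 * (2 ^ 14 * (K * n)) * (2 ^ 14 * (K * n) * 2 ^ 20)))
      = n ^ 2 * (2 ^ 49 * K ^ 5).
    rewrite -[49]/(1 + (14 + (14 + 20))) !(expnD 2 _ _) expn1.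
    move: (2 ^ 14) (2 ^ 20) => x y; rewrite !expnS !expn0; lia.
  by rewrite leq_mul2l leq_mul2r p50 !orbT.
rewrite -expnD leq_mul2l leq_exp2l ?orbT //.
by apply: leq_trans K4.
Qed.

Local Open Scope ring_scope.

Theorem theorem1 (R : realType) :
  exists c C : R, 0 < c /\ 0 < C /\
    forall (k : nat) (T : finType) (F H : sgraph T) (eps : R),
      (0 < k)%N -> #|T| = k ->
      edges F \proper edges H ->
      0 < eps -> eps < 1 ->
      exists (V : finType) (G : kpartite k V),
        forall P : {set {set V}},
          regular_partition eps H F G P ->
          (rtwr (1 / (eps `^ c * k%:R `^ (C * k%:R))) <= #|P|)%N.
Proof.
(* [eps_inv] is quadratic in the number of blocks, whence the square root *)
exists 2^-1, 50%:R; do 2![split; first by rewrite ?invr_gt0 ltr0n].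
move=> k T F H eps k0 card_T FH eps0 eps1.
have [c codes] := choice msize_code.
have card_TI : #|T| = #|'I_k| by rewrite card_ord.
have [i0 [i1 [i01 sep]]] := separating_pair card_TI (proper_card FH).
have k1 : (1 < k)%N by rewrite -[k]card_ord (cardD1 i0) (cardD1 i1) !inE eq_sym i01.
rewrite powR12_sqrt ?(ltW eps0) // -natrM powR_mulrn // /rtwr.
(* the first four blocks only start the growth of [msize] *)
set z := 1 / _; set n := Num.truncn z.
exists (vtx k n.+4), (chain_graph i0 i1 n.+4 c) => P regP.
have [partP _] := regP.
have [n_0|n_gt0] := posnP n.
  have -> : twr n = 1%N by rewrite n_0.
  apply/card_gt0P.
  have v0 : vtx k n.+4 by exact: (i0, (ord0, Ordinal (bsize_gt0 n.+4))).
  by exists (pblock P v0); apply: pblock_in.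
have s0 : 0 < Num.sqrt eps by rewrite sqrtr_gt0.
have K0 : 0 < k%:R ^+ (50 * k) :> R by rewrite exprn_gt0 // ltr0n.
have nz : n%:R <= z by rewrite truncn_le // divr_ge0 // mulr_ge0 // ltW.
have scale : eps * (n ^ 2 * (k ^ k) ^ 100)%:R <= 1.
  move: nz; rewrite /z ler_pdivlMr ?mulr_gt0 // => nz.
  have : (n%:R * (Num.sqrt eps * k%:R ^+ (50 * k))) ^+ 2 <= 1.
    by rewrite expr_le1 // !mulr_ge0 // ltW.
  rewrite !exprMn sqr_sqrtr ?(ltW eps0) // mulrCA.
  have -> : ((k ^ k) ^ 100 = (k ^ (50 * k)) ^ 2)%N by rewrite -!expnM; congr expn; lia.
  by rewrite natrM !natrX.
have small : eps * (eps_inv k (2 ^ 20) (2 ^ 11 * (k * n.+4.+1)))%:R <= 1.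
  apply: le_trans scale; apply: ler_wpM2l; first exact: ltW.
  by rewrite ler_nat scale_budget.
have gap : eps * (2 * (k ^ k) ^ 2)%:R < 1.
  apply: lt_le_trans scale; rewrite ltr_pM2l // ltr_nat.
  have K4 : (4 <= k ^ k)%N.
    apply: (@leq_trans (2 ^ 2)%N) => //; apply: leq_trans (leq_expl 2 k1) _.
    by rewrite leq_exp2l.
  apply: (@leq_trans ((k ^ k) ^ 3)%N); last first.
    by rewrite -[leqLHS]mul1n leq_mul ?expn_gt0 ?n_gt0 // leq_exp2l // (leq_trans _ K4).
  by move: (k ^ k)%N K4 => K K4; rewrite [leqRHS]expnS ltn_pmul2r ?expn_gt0; lia.
have bad := blocks_refined i01 card_T sep codes (ltW eps0) small gap regP (leqnn n.+4).
have b0 := bsize_gt0 n.+4.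
have s_gt0 : (0 < bsize n.+4 %/ msize n.+4)%N.
  by move: b0; rewrite {1}(bsize_div (leqnn n.+4)) muln_gt0 => /andP[].
have := parts_ge partP s_gt0 (fun i => card_cluster i0 i1 i (leqnn n.+4)) bad.
case/andP: (msize_growth n) => _ big small_m.
have : (2 * twr n <= 2 * #|P|)%N.
  apply: leq_trans small_m; apply: leq_trans big.
  by rewrite leq_mul2r orbC -[X in (X <= _)%N]expn1 leq_exp2l.
by rewrite leq_pmul2l.
Qed.
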